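(* Let $E$ be a Hilbert $C^*$-module over a $C^*$-algebra $\mathcal{A}$. Let $T:\mathrm{dom}(T)\to E$ be a selfadjoint regular operator in $E$ and let $V:\mathrm{dom}(V)\to E$ be a symmetric operator in $E$ such that $\mathrm{dom}(T)\subset\mathrm{dom}(V)$. Suppose that there exists $b\in\mathbb{R}_+$ such that for all $x\in\mathrm{dom}(T)$, as an inequality in $\mathcal{A}$, $$\langle Vx,Vx\rangle\le\langle Tx,Tx\rangle+b\,\langle x,x\rangle.$$ Then $T+V$ with domain $\mathrm{dom}(T)$ is essentially selfadjoint and regular, i.e. its closure is selfadjoint and regular.
   Context: $C^*$-algebras are not assumed unital. A Hilbert $C^*$-module $E$ over $\mathcal{A}$ is a right $\mathcal{A}$-module with an $\mathcal{A}$-valued inner product $\langle\cdot,\cdot\rangle$ (conjugate linear in the first, linear in the second variable), complete in the norm $\|x\|=\|\langle x,x\rangle\|^{1/2}$. A semiregular operator in $E$ is an operator $T:\mathrm{dom}(T)\to E$ defined on a dense $\mathcal{A}$-submodule $\mathrm{dom}(T)\subset E$ whose adjoint $T^*$ is densely defined; here $y\in\mathrm{dom}(T^* )$ iff there is $z=T^*y\in E$ with $\langle Tx,y\rangle=\langle x,z\rangle$ for all $x\in\mathrm{dom}(T)$. Such a $T$ is automatically $\mathcal{A}$-linear and closable. A closed semiregular operator $T$ is called regular if $I+T^*T$ has dense range (it is then invertible). A densely defined operator $T$ (domain a dense $\mathcal{A}$-submodule) is symmetric if $T\subset T^*$ and selfadjoint if $T=T^*$. *)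

(* Defs.v *)
From HB Require Import structures.
From mathcomp Require Import all_boot all_order all_algebra.
From mathcomp Require Import all_classical all_reals all_analysis.
From mathcomp Require Import complex.

Set Implicit Arguments.
Unset Strict Implicit.
Unset Printing Implicit Defensive.

Import Order.TTheory GRing.Theory Num.Theory.
Import numFieldNormedType.Exports.

Local Open Scope classical_set_scope.
Local Open Scope ring_scope.
Local Open Scope complex_scope.

(* The multiplication is a separate operation rather than a ring structure:
   rings in ssralg have a unit, and C*-algebras here need not. *)
HB.mixin Record isCStarAlgebra (R : realType) A
    of CompleteNormedModule R[i] A := {
  cmul : A -> A -> A ;
  cstar : A -> A ;
  cmulA : forall a b c : A, cmul a (cmul b c) = cmul (cmul a b) c ;
  cmulDl : forall a b c : A, cmul (a + b) c = cmul a c + cmul b c ;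
  cmulDr : forall a b c : A, cmul a (b + c) = cmul a b + cmul a c ;
  cmulZl : forall (l : R[i]) (a b : A), cmul (l *: a) b = l *: cmul a b ;
  cmulZr : forall (l : R[i]) (a b : A), cmul a (l *: b) = l *: cmul a b ;
  cstarK : forall a : A, cstar (cstar a) = a ;
  cstarD : forall a b : A, cstar (a + b) = cstar a + cstar b ;
  cstarZ : forall (l : R[i]) (a : A), cstar (l *: a) = conjc l *: cstar a ;
  cstarM : forall a b : A, cstar (cmul a b) = cmul (cstar b) (cstar a) ;
  cnormM_le : forall a b : A, `|cmul a b| <= `|a| * `|b| ;
  cnorm_star : forall a : A, `|cmul (cstar a) a| = `|a| ^+ 2
}.

#[short(type="cstarAlgebraType")]
HB.structure Definition CStarAlgebra (R : realType) :=
  { A of isCStarAlgebra R A & CompleteNormedModule R[i] A }.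

Definition cpos (R : realType) (A : cstarAlgebraType R) (a : A) : Prop :=
  exists c : A, a = cmul (cstar c) c.

Definition cle (R : realType) (A : cstarAlgebraType R) (a b : A) : Prop :=
  cpos (b - a).

(* Conjugate linearity of inner in its first variable follows from innerC.
   The norm of E satisfies |x| = |<x, x>|^(1/2) by inner_norm, which also
   makes the inner product definite. *)
HB.mixin Record isHilbertModule (R : realType) (A : cstarAlgebraType R) E
    of CompleteNormedModule R[i] E := {
  modact : E -> A -> E ;
  inner : E -> E -> A ;
  modactA : forall (x : E) (a b : A),
    modact x (cmul a b) = modact (modact x a) b ;
  modactDl : forall (x y : E) (a : A),
    modact (x + y) a = modact x a + modact y a ;
  modactDr : forall (x : E) (a b : A),
    modact x (a + b) = modact x a + modact x b ;
  modactZl : forall (l : R[i]) (x : E) (a : A),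
    modact (l *: x) a = l *: modact x a ;
  modactZr : forall (l : R[i]) (x : E) (a : A),
    modact x (l *: a) = l *: modact x a ;
  innerDr : forall x y z : E, inner x (y + z) = inner x y + inner x z ;
  innerZr : forall (l : R[i]) (x y : E), inner x (l *: y) = l *: inner x y ;
  inner_act : forall (x y : E) (a : A),
    inner x (modact y a) = cmul (inner x y) a ;
  innerC : forall x y : E, cstar (inner x y) = inner y x ;
  inner_pos : forall x : E, cpos (inner x x) ;
  inner_norm : forall x : E, `|x| ^+ 2 = `|inner x x|
}.

#[short(type="hilbertModuleType")]
HB.structure Definition HilbertModule (R : realType)
    (A : cstarAlgebraType R) :=
  { E of isHilbertModule R A E & CompleteNormedModule R[i] E }.

Section Operators.
Context {R : realType} {A : cstarAlgebraType R} {E : hilbertModuleType A}.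

Definition submodule (D : set E) : Prop :=
  [/\ D 0,
      forall x y, D x -> D y -> D (x + y),
      forall (l : R[i]) x, D x -> D (l *: x) &
      forall x (a : A), D x -> D (modact x a)].

(* A partially defined map: the values of opfun outside dom are irrelevant,
   and none of the notions below depends on them. *)
Record operator := Operator { dom : set E ; opfun :> E -> E }.

Definition graph (T : operator) : set (E * E) :=
  [set p | dom T p.1 /\ p.2 = T p.1].

Definition op_sub (S T : operator) : Prop :=
  forall x, dom S x -> dom T x /\ S x = T x.

Definition op_eq (S T : operator) : Prop := op_sub S T /\ op_sub T S.

Definition is_adjoint_value (T : operator) (y z : E) : Prop :=
  forall x, dom T x -> inner (T x) y = inner x z.

(* For y in the domain and dom T dense, the value z is unique. *)
Definition adjoint (T : operator) : operator :=
  Operator [set y | exists z, is_adjoint_value T y z]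
           (fun y => xget 0 [set z | is_adjoint_value T y z]).

(* Linearity is not required: it follows whenever the adjoint is densely
   defined, hence for semiregular, symmetric and selfadjoint operators. *)
Definition densely_defined (T : operator) : Prop :=
  submodule (dom T) /\ dense (dom T).

Definition semiregular (T : operator) : Prop :=
  densely_defined T /\ dense (dom (adjoint T)).

Definition symmetric_op (T : operator) : Prop :=
  densely_defined T /\ op_sub T (adjoint T).

Definition selfadjoint (T : operator) : Prop :=
  densely_defined T /\ op_eq T (adjoint T).

Definition closed_op (T : operator) : Prop := closed (graph T).

Definition op_add (S T : operator) : operator :=
  Operator (dom S `&` dom T) (fun x => S x + T x).

Definition op_comp (S T : operator) : operator :=
  Operator [set x | dom T x /\ dom S (T x)] (fun x => S (T x)).

Definition op_id : operator := Operator setT id.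

Definition range_op (T : operator) : set E := T @` dom T.

Definition regular (T : operator) : Prop :=
  [/\ semiregular T, closed_op T &
      dense (range_op (op_add op_id (op_comp (adjoint T) T)))].

Definition is_closure (S T : operator) : Prop :=
  graph S = closure (graph T).

End Operators.

Arguments operator {R A} E.

(* Main.v *)
Require Import Defs.
From mathcomp Require Import all_boot all_order all_algebra.
From mathcomp Require Import all_classical all_reals all_analysis.
From mathcomp Require Import complex ring lra.

Import Order.TTheory GRing.Theory Num.Theory.
Import numFieldNormedType.Exports.
Local Open Scope classical_set_scope.
Local Open Scope ring_scope.
Local Open Scope complex_scope.
Set Implicit Arguments.
Unset Strict Implicit.
Unset Printing Implicit Defensive.

(** The proof follows Wuest's argument. Put [S = T + V] on the domain of [T].
    It is symmetric, so the point is that [S + i] and [S - i] have dense range: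
    then the closure of [S] is the adjoint of [S], it is selfadjoint, and it is
    regular since [1 + S^2 = (S + i) (S - i)] ([adjoint_is_closure],
    [adjoint_selfadjoint], [adjoint_regular]). Dense ranges may be proved for
    [S + im] with any real [m] of large absolute value and either sign, because
    [m] can be moved by less than its absolute value ([dense_range_shift]).

    If [m^2 >= b], the hypothesis gives [|V x| <= |(T + im) x|]. So for [t < 1]
    the operator [tV] has relative bound [t < 1] with respect to [T + im], and
    [T + tV + im] has dense range by the Neumann series
    ([dense_range_perturbation]). When [t] tends to [1], the approximate
    solutions of [(T + tV + im) x = y] have residuals [y - (S + im) x] that stay
    bounded and tend weakly to [0]. In a Hilbert space one would test them
    against a vector orthogonal to the range; in a Hilbert module a proper
    closed submodule may have no nonzero orthogonal vector. But a bounded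
    weakly null sequence has averages that tend to [0] in norm (Banach and
    Saks), by a computation with inner products that is valid in Hilbert
    modules, and an average of residuals is a residual ([dense_range_wuest]).

    The order of [A] enters only through the monotonicity of the norm,
    [|a^* a| <= |a^* a + b^* b|] ([nrm_starM_leD]). Positivity being defined by
    [a = c^* c], this contains the theorem of Kelley and Vaught that [c^* c]
    has a selfadjoint square root ([starM_sqrt]). It is proved here without
    unit and without spectral theory, inside the adjointable operators on [A].
    The tools are the square root of [1 - X] for a selfadjoint contraction [X],
    obtained by iteration ([sqrt_one_minus]), and the equality of the norms of
    [x + iy] and [x - iy] when [x^* y = y^* x] ([normal_le]). *)

(** * Identities in a module over a field *)

Section LinearReflection.
Context {K : fieldType} {V : lmodType K}.

(** Syntax of linear combinations: an equation between two of them holds in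
    every module as soon as the coefficients of each atom agree, and comparing
    coefficients is a problem for [field]. *)
Inductive lterm :=
  | LZero
  | LAtom of nat
  | LAdd of lterm & lterm
  | LOpp of lterm
  | LScale of K & lterm.

Fixpoint leval (e : seq V) (t : lterm) : V :=
  match t with
  | LZero => 0
  | LAtom n => e`_n
  | LAdd t u => leval e t + leval e u
  | LOpp t => - leval e t
  | LScale c t => c *: leval e t
  end.

Fixpoint lcoef (t : lterm) (i : nat) : K :=
  match t with
  | LZero => 0
  | LAtom n => if n == i then 1 else 0
  | LAdd t u => lcoef t i + lcoef u i
  | LOpp t => - lcoef t i
  | LScale c t => c * lcoef t i
  end.

Fixpoint lcoef_eq (t u : lterm) (n : nat) : Prop :=
  if n is m.+1 then lcoef t m = lcoef u m /\ lcoef_eq t u m else True.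

Lemma leval_sum e t : leval e t = \sum_(i < size e) lcoef t i *: e`_i.
Proof.
elim: t => [|n|t IHt u IHu|t IHt|c t IHt] /=.
- by rewrite big1 // => i _; rewrite scale0r.
- have [lt_n|ge_n] := ltnP n (size e).
    rewrite (bigD1 (Ordinal lt_n)) //= eqxx scale1r big1 ?addr0 // => i.
    by rewrite -val_eqE /= eq_sym => /negbTE ->; rewrite scale0r.
  rewrite nth_default // big1 // => i _.
  by rewrite gtn_eqF ?scale0r // (leq_trans _ ge_n).
- by rewrite IHt IHu -big_split /=; apply: eq_bigr => i _; rewrite scalerDl.
- by rewrite IHt -sumrN; apply: eq_bigr => i _; rewrite scaleNr.
- by rewrite IHt scaler_sumr; apply: eq_bigr => i _; rewrite scalerA.
Qed.

Lemma leval_eq e t u : lcoef_eq t u (size e) -> leval e t = leval e u.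
Proof.
move=> eq_tu; rewrite !leval_sum; apply: eq_bigr => i _; congr (_ *: _).
elim: (size e) i eq_tu => [[]//|n IHn] i /= [eq_n /IHn eq_tu].
have [lt_i|] := ltnP i n; first exact: (eq_tu (Ordinal lt_i)).
case: i => i /= lt_in ge_in.
by have -> : i = n by apply/eqP; rewrite eqn_leq -ltnS lt_in.
Qed.

End LinearReflection.

Ltac lin_index x e :=
  lazymatch e with
  | x :: _ => constr:(0%N)
  | _ :: ?e' => let n := lin_index x e' in constr:(S n)
  end.

Ltac lin_mem x e :=
  lazymatch e with
  | x :: _ => constr:(true)
  | _ :: ?e' => lin_mem x e'
  | _ => constr:(false)
  end.

Ltac lin_atoms e t :=
  lazymatch t with
  | (?a + ?b)%R => let e1 := lin_atoms e a in lin_atoms e1 b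
  | (- ?a)%R => lin_atoms e a
  | (_ *: ?a)%R => lin_atoms e a
  | 0%R => e
  | _ => lazymatch lin_mem t e with
         | true => e
         | false => constr:(t :: e)
         end
  end.

Ltac lin_reify K e t :=
  lazymatch t with
  | (?a + ?b)%R =>
    let ra := lin_reify K e a in
    let rb := lin_reify K e b in constr:(@LAdd K ra rb)
  | (- ?a)%R => let ra := lin_reify K e a in constr:(@LOpp K ra)
  | (?c *: ?a)%R => let ra := lin_reify K e a in constr:(@LScale K c ra)
  | 0%R => constr:(@LZero K)
  | _ => let n := lin_index t e in constr:(@LAtom K n)
  end.

(** The coefficients are compared by their real and imaginary parts, so that
    only real unknowns and explicit complex numbers may occur in them. *)
Ltac clin :=
  lazymatch goal with
  | R : realType |- @eq ?V ?l ?r =>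
    let e0 := lin_atoms (@nil V) l in
    let e := lin_atoms e0 r in
    let K := constr:(complex R : fieldType) in
    let rl := lin_reify K e l in
    let rr := lin_reify K e r in
    refine (@leval_eq K _ e rl rr _);
    rewrite /=; repeat split; apply/eqP; rewrite eq_complex /=;
    apply/andP; split; apply/eqP; field; done
  end.

(** * The norm as a real number *)

Section RealNorm.
Context {R : realType} {V : completeNormedModType R[i]}.
Implicit Types x y z : V.

(** Norms are elements of [R[i]] in a normed module over the complex numbers;
    their real parts are totally ordered, which real arithmetic requires. *)
Definition nrm x : R := complex.Re `|x|.

Lemma nrmE x : `|x| = (nrm x)%:C.
Proof. by rewrite /nrm; case: `|x| (ger0_Im (normr_ge0 x)) => a b /= ->. Qed.

Lemma nrm_ge0 x : 0 <= nrm x.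
Proof. by rewrite -lecR -nrmE normr_ge0. Qed.

Lemma nrm0 : nrm 0 = 0.
Proof. by rewrite /nrm normr0. Qed.

Lemma nrm0_eq0 x : nrm x = 0 -> x = 0.
Proof. by move=> x0; apply/eqP; rewrite -normr_eq0 nrmE x0. Qed.

Lemma nrm_gt0 x : x <> 0 -> 0 < nrm x.
Proof.
by rewrite lt_neqAle nrm_ge0 eq_sym andbT => x0; apply/eqP => /nrm0_eq0.
Qed.

Lemma nrmD x y : nrm (x + y) <= nrm x + nrm y.
Proof. by rewrite -lecR rmorphD /= -!nrmE ler_normD. Qed.

Lemma nrmN x : nrm (- x) = nrm x.
Proof. by rewrite /nrm normrN. Qed.

Lemma nrmB x y : nrm (x - y) <= nrm x + nrm y.
Proof. by rewrite -(nrmN y) nrmD. Qed.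

Lemma nrm_sub x y : nrm (x - y) = nrm (y - x).
Proof. by rewrite -nrmN opprB. Qed.

Lemma nrmDB x y z : nrm (x - z) <= nrm (x - y) + nrm (y - z).
Proof. by rewrite -[x in leLHS](subrK y) -addrA nrmD. Qed.

Lemma nrm_leD x y : nrm x <= nrm (x - y) + nrm y.
Proof. by rewrite -[x in leLHS](subrK y) nrmD. Qed.

Lemma nrmZ (c : R[i]) x : nrm (c *: x) = Normc.normc c * nrm x.
Proof.
rewrite /nrm normrZ nrmE.
by case: c => a b; rewrite normc_def /= mul0r subr0.
Qed.

Lemma nrmZr (r : R) x : 0 <= r -> nrm (r%:C *: x) = r * nrm x.
Proof. by move=> r0; rewrite nrmZ /= expr0n addr0 sqrtr_sqr ger0_norm. Qed.

Lemma nrmZi (r : R) x : nrm ((0 +i* r) *: x) = `|r| * nrm x.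
Proof. by rewrite nrmZ /= expr0n add0r sqrtr_sqr. Qed.

Lemma nrmi x : nrm ('i *: x) = nrm x.
Proof. by rewrite nrmZi normr1 mul1r. Qed.

(** Passing to the limit in an identity: [e] is the precision of the
    approximations and [C] collects the norms that multiply it. *)
Lemma eq_of_nrm_le x y (C : R) :
  (forall e : R, 0 < e -> nrm (x - y) <= C * e) -> x = y.
Proof.
move=> le_e; apply/eqP; rewrite -subr_eq0; apply/eqP/nrm0_eq0/eqP.
rewrite eq_le nrm_ge0 andbT leNgt; apply/negP => n0.
have C0 : 0 < `|C| + 1 by rewrite ltr_wpDl.
have := le_e _ (divr_gt0 n0 C0); rewrite mulrCA leNgt => /negP; apply.
rewrite -[ltRHS]mulr1 ltr_pM2l // ltr_pdivrMr // mul1r.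
by apply: le_lt_trans (ler_norm C) _; rewrite ltrDl.
Qed.

Lemma nbhs_nrm x (B : set V) : nbhs x B ->
  exists2 e : R, 0 < e & forall y, nrm (y - x) < e -> B y.
Proof.
move=> /nbhs_ballP[[a b] /=]; rewrite ltcE /= => /andP[/eqP -> a0] sub_B.
exists a => // y yx; apply: sub_B.
by rewrite -ball_normE /ball_ /= nrmE ltcR nrm_sub.
Qed.

Lemma dense_nrm (D : set V) : dense D <->
  forall x (e : R), 0 < e -> exists2 u, D u & nrm (x - u) < e.
Proof.
split=> [dD x e e0 | H O [x Ox] oO].
  have e0C : 0 < e%:C by rewrite ltcR.
  have [u [/= xu Du]] : (ball x e%:C)^° `&` D !=set0.
    apply: dD; last exact: open_interior.
    by exists x; apply: nbhsx_ballx.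
  exists u => //; move/interior_subset: xu.
  by rewrite -ball_normE /ball_ /= nrmE ltcR.
have /nbhs_nrm[e e0 sub_O] : nbhs x O by apply: open_nbhs_nbhs.
have [u Du xu] := H x _ e0; exists u; split=> //; apply: sub_O.
by rewrite nrm_sub.
Qed.

(** Completeness with an explicit rate, which the limit inherits. *)
Lemma cvg_rate (u : nat -> V) (C : R) :
  (forall m n, (n <= m)%N -> nrm (u m - u n) <= C / n.+1%:R) ->
  exists l, forall n, nrm (u n - l) <= C / n.+1%:R.
Proof.
move=> cau.
have C0 : 0 <= C.
  by have := le_trans (nrm_ge0 _) (cau 0%N 0%N (leqnn _)); rewrite divr1.
have small (e : R) : 0 < e -> exists N : nat, C / N.+1%:R < e.
  move=> e0; exists (Num.trunc (C / e)).
  by rewrite ltr_pdivrMr ?ltr0Sn // mulrC -ltr_pdivrMr // truncnS_gt.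
have /cvg_ex[l ul] : cvgn u.
  apply/cauchy_cvgP/cauchy_exP => -[a b]; rewrite ltcE /= => /andP[/eqP -> a0].
  have [N HN] := small a a0.
  exists (u N); exists N => // n /= Nn; rewrite -ball_normE /ball_ /= nrmE ltcR.
  by rewrite nrm_sub; apply: le_lt_trans (cau _ _ Nn) HN.
exists l => n; rewrite leNgt; apply/negP => Cn.
have e0C : 0 < (nrm (u n - l) - C / n.+1%:R)%:C by rewrite ltcR subr_gt0.
have /cvgrPdist_lt /(_ _ e0C)[N _ HN] := ul.
have := HN (maxn N n) (leq_maxl _ _).
rewrite nrmE ltcR (nrm_sub l (u (maxn _ _))) => lt_m.
have := cau _ _ (leq_maxr N n); rewrite nrm_sub => le_n.
have := nrmDB (u n) (u (maxn N n)) l.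
by move: lt_m le_n; move: (C / n.+1%:R) => r lt_m le_n; lra.
Qed.

End RealNorm.

Lemma le_rate {R : realType} (a b C : R) :
  (forall n : nat, a <= b + C / n.+1%:R) -> a <= b.
Proof.
move=> le_n; rewrite leNgt; apply/negP => lt_ba.
have ab0 : 0 < a - b by lra.
have := le_n (Num.trunc (C / (a - b))).
rewrite -lerBlDl leNgt => /negP; apply.
by rewrite ltr_pdivrMr ?ltr0Sn // mulrC -ltr_pdivrMr // truncnS_gt.
Qed.

Lemma nrm_rate0 {R : realType} {V : completeNormedModType R[i]} (x : V) (C : R) :
  (forall n : nat, nrm x <= C / n.+1%:R) -> x = 0.
Proof.
move=> le_n; apply: nrm0_eq0; apply/eqP; rewrite eq_le nrm_ge0 andbT.
by apply: (@le_rate _ _ _ C) => n; rewrite add0r.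
Qed.

(** * A C*-algebra as a Hilbert module over itself *)

Section CStar.
Context {R : realType} {A : cstarAlgebraType R}.
Implicit Types (a b x y z : A).

Lemma cmul0l a : cmul 0 a = 0.
Proof. by apply: (addIr (cmul 0 a)); rewrite -cmulDl !add0r. Qed.
Lemma cmul0r a : cmul a 0 = 0.
Proof. by apply: (addIr (cmul a 0)); rewrite -cmulDr !add0r. Qed.
Lemma cmulNr a b : cmul a (- b) = - cmul a b.
Proof. by rewrite -scaleN1r cmulZr scaleN1r. Qed.

Lemma nrmM a b : nrm (cmul a b) <= nrm a * nrm b.
Proof. by rewrite -lecR rmorphM /= -!nrmE cnormM_le. Qed.

Lemma nrm_starM a : nrm (cmul (cstar a) a) = nrm a ^+ 2.
Proof.
have := cnorm_star a; rewrite !nrmE -rmorphXn => /eqP.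
by rewrite eq_complex => /andP[/eqP].
Qed.

(** The C*-identity gives [|b|^2 <= |b^*| |b|], whence one inequality for [b]
    and the other one for [b^*]. *)
Lemma nrm_star a : nrm (cstar a) = nrm a.
Proof.
have le_star b : nrm b <= nrm (cstar b).
  have [/eqP|b0] := eqVneq (nrm b) 0; first by move/eqP ->; exact: nrm_ge0.
  have bgt0 : 0 < nrm b by rewrite lt_neqAle eq_sym b0 nrm_ge0.
  by rewrite -(ler_pM2r bgt0) -expr2 -nrm_starM nrmM.
by apply/eqP; rewrite eq_le le_star andbT -{2}(cstarK a) le_star.
Qed.

Definition ip x y := cmul (cstar x) y.

Lemma ipDl x y z : ip (x + y) z = ip x z + ip y z.
Proof. by rewrite /ip cstarD cmulDl. Qed.
Lemma ipDr x y z : ip z (x + y) = ip z x + ip z y.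
Proof. exact: cmulDr. Qed.
Lemma ipZl (l : R[i]) x z : ip (l *: x) z = conjc l *: ip x z.
Proof. by rewrite /ip cstarZ cmulZl. Qed.
Lemma ipZr (l : R[i]) x z : ip z (l *: x) = l *: ip z x.
Proof. exact: cmulZr. Qed.
Lemma ipNl x z : ip (- x) z = - ip x z.
Proof.
apply/eqP; rewrite -addr_eq0 -ipDl addNr /ip.
have -> : cstar 0 = 0 :> A by apply: (addIr (cstar 0)); rewrite -cstarD !add0r.
by rewrite cmul0l.
Qed.
Lemma ipNr x z : ip z (- x) = - ip z x.
Proof. exact: cmulNr. Qed.
Lemma ipC x y : cstar (ip x y) = ip y x.
Proof. by rewrite /ip cstarM cstarK. Qed.
Lemma nrm_ip x y : nrm (ip x y) <= nrm x * nrm y.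
Proof. by rewrite -(nrm_star x) nrmM. Qed.
Lemma nrm_ipxx x : nrm (ip x x) = nrm x ^+ 2.
Proof. exact: nrm_starM. Qed.

Definition ipE := (ipDl, ipDr, ipZl, ipZr, ipNl, ipNr).

Lemma ip_inj x y : (forall z, ip z x = ip z y) -> x = y.
Proof.
move=> eq_xy; apply/eqP; rewrite -subr_eq0; apply/eqP/nrm0_eq0/eqP.
by rewrite -sqrf_eq0 -nrm_ipxx ipDr ipNr eq_xy subrr nrm0.
Qed.

(** Under this hypothesis [x + iy] and [x - iy] have the same square
    [<x, x> + <y, y>], hence the same norm, and [x] is their mean. Applied
    to commuting selfadjoint operators it compares squares before anything is
    known about positive elements; [nrm_starM_leD] removes the hypothesis. *)
Lemma normal_le x y : ip x y = ip y x ->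
  nrm x ^+ 2 <= nrm (ip x x + ip y y).
Proof.
move=> xy.
have eP : ip (x + 'i *: y) (x + 'i *: y) = ip x x + ip y y.
  by rewrite !ipE xy; clin.
have eN : ip (x - 'i *: y) (x - 'i *: y) = ip x x + ip y y.
  by rewrite !ipE xy; clin.
rewrite -eP nrm_ipxx ler_sqr ?nnegrE ?nrm_ge0 //.
have /eqP := nrm_ipxx (x - 'i *: y).
rewrite eN -eP nrm_ipxx eqrXn2 ?nrm_ge0 // => /eqP n_eq.
have := nrmD (x + 'i *: y) (x - 'i *: y); rewrite -n_eq.
have -> : x + 'i *: y + (x - 'i *: y) = 2%:C *: x by clin.
by rewrite nrmZr //; lra.
Qed.

End CStar.

(** * Adjointable operators on a C*-algebra *)

Section Adjointable.
Context {R : realType} {A : cstarAlgebraType R}.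
Implicit Types (c x y z : A) (F G : A -> A).

(** Adjointable maps from [A] to itself play the role of the unitization:
    they contain the identity and, by [adj_mul], left multiplications.
    Linearity is automatic. *)
Definition adj F G := forall x y, ip (F x) y = ip x (G y).
Definition contraction F := forall z, nrm (F z) <= nrm z.

Lemma adj_sym F G : adj F G -> adj G F.
Proof. by move=> FG x y; rewrite -ipC -FG ipC. Qed.

Lemma adj_additive F G : adj F G -> {morph F : x y / x + y}.
Proof.
by move=> /adj_sym FG x y; apply: ip_inj => z; rewrite ipDr -!FG ipDr.
Qed.

Lemma adj_homogeneous F G : adj F G -> forall l : R[i], {morph F : x / l *: x}.
Proof.
by move=> /adj_sym FG l x; apply: ip_inj => z; rewrite ipZr -!FG ipZr.
Qed.

Lemma adj_opp F G : adj F G -> {morph F : x / - x}.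
Proof.
by move=> FG x; rewrite -(scaleN1r x) (adj_homogeneous FG) scaleN1r.
Qed.

Definition adjE F G (FG : adj F G) :=
  (adj_additive FG, adj_opp FG, adj_homogeneous FG).

Lemma adj_comp F F' G G' : adj F F' -> adj G G' -> adj (F \o G) (G' \o F').
Proof. by move=> FF' GG' x y /=; rewrite FF' GG'. Qed.

Lemma adj_sq F G : adj F G -> forall z, nrm (F z) ^+ 2 = nrm (ip z (G (F z))).
Proof. by move=> FG z; rewrite -nrm_ipxx FG. Qed.

Lemma adj_mul c : adj (cmul c) (cmul (cstar c)).
Proof. by move=> x y; rewrite /ip cstarM cmulA. Qed.

Lemma adj_contraction F G : adj F G -> contraction F -> contraction G.
Proof.
move=> FG cF z; have [->|/nrm_gt0 Gz0] := pselect (G z = 0).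
  by rewrite nrm0 nrm_ge0.
rewrite -(ler_pM2r Gz0) -expr2 (adj_sq (adj_sym FG)).
by apply: le_trans (nrm_ip _ _) _; rewrite ler_wpM2l ?nrm_ge0.
Qed.

(** * Square roots of positive operators *)

(** If [X] is a selfadjoint contraction, [Y = 1 - sqrt (1 - X)] is the fixed
    point of [Y |-> (X + Y^2) / 2]. The iteration from [0] is dominated by the
    same iteration for the scalar [X = 1], which increases to [1]. *)
Section SquareRootIteration.
Context (X : A -> A) (X_sa : adj X X) (X_contr : contraction X).

Fixpoint sqrt_iter (n : nat) z : A :=
  if n is m.+1 then 2^-1%:C *: (X z + sqrt_iter m (sqrt_iter m z)) else 0.

Fixpoint sqrt_bound (n : nat) : R :=
  if n is m.+1 then (1 + sqrt_bound m ^+ 2) / 2 else 0.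

Lemma sqrt_bound_ge0_le1 n : 0 <= sqrt_bound n <= 1.
Proof.
by elim: n => [|n /andP[n0 n1]] /=; rewrite ?lexx ?ler01 //; apply/andP; split; nra.
Qed.

(** The defect [s = 1 - t] obeys [s |-> s - s^2 / 2], which keeps it below
    [2 / (n + 2)]. *)
Lemma sqrt_bound_rate n : 1 - sqrt_bound n <= 2 / n.+1%:R.
Proof.
suff : (1 - sqrt_bound n) * n.+2%:R <= 2.
  have [t0 t1] := andP (sqrt_bound_ge0_le1 n).
  rewrite ler_pdivlMr ?ltr0Sn // -[n.+2]addn1 natrD mulrDr; lra.
elim: n => [|n IHn] /=; first by rewrite subr0 mul1r.
have [t0 t1] := andP (sqrt_bound_ge0_le1 n).
rewrite -[n.+3]addn1 natrD.
have : 2 <= n.+2%:R :> R by rewrite ler_nat.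
move: IHn t0 t1; move: (sqrt_bound n) (n.+2%:R : R) => t N IHn t0 t1 N2.
have -> : (1 - (1 + t ^+ 2) / 2) * (N + 1) = (1 - t) * (N + 1) * (1 - (1 - t) / 2).
  by field.
have s2 : (1 - t) * N <= 2 by [].
nra.
Qed.

Lemma sqrt_bound_mono n : sqrt_bound n <= sqrt_bound n.+1.
Proof. by have := sqr_ge0 (1 - sqrt_bound n); rewrite /=; nra. Qed.

Lemma sqrt_iter_sa n : adj (sqrt_iter n) (sqrt_iter n).
Proof.
elim: n => [|n IHn] x y /=.
  by rewrite -(scale0r 0) ipZl ipZr conjc0 !scale0r.
by rewrite !ipE X_sa !IHn; clin.
Qed.

Lemma sqrt_iter_le n z : nrm (sqrt_iter n z) <= sqrt_bound n * nrm z.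
Proof.
elim: n z => [|n IHn] z /=; first by rewrite nrm0 mul0r.
rewrite nrmZr //.
have [t0 t1] := andP (sqrt_bound_ge0_le1 n).
have := nrmD (X z) (sqrt_iter n (sqrt_iter n z)).
have := X_contr z; have := IHn (sqrt_iter n z); have := ler_wpM2l t0 (IHn z).
rewrite mulrA -expr2; lra.
Qed.

(** Since [Y1^2 - Y0^2 = Y1 (Y1 - Y0) + (Y1 - Y0) Y0], the increments are
    dominated by those of the scalar iteration. *)
Lemma sqrt_iter_step n z :
  nrm (sqrt_iter n.+1 z - sqrt_iter n z) <=
  (sqrt_bound n.+1 - sqrt_bound n) * nrm z.
Proof.
elim: n z => [|n IHn] z; first by have := sqrt_iter_le 1 z; rewrite /= !subr0.
set Y1 := sqrt_iter n.+1; set Y0 := sqrt_iter n.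
have -> : sqrt_iter n.+2 z - Y1 z =
    2^-1%:C *: (Y1 (Y1 z - Y0 z) + (Y1 (Y0 z) - Y0 (Y0 z))).
  rewrite /Y1 (adjE (sqrt_iter_sa n.+1)) -/Y1.
  have -> : sqrt_iter n.+2 z = 2^-1%:C *: (X z + Y1 (Y1 z)) by [].
  have -> : Y1 z = 2^-1%:C *: (X z + Y0 (Y0 z)) by [].
  by rewrite /Y1 !(adjE (sqrt_iter_sa n.+1)) -/Y1; clin.
rewrite nrmZr //.
have := nrmD (Y1 (Y1 z - Y0 z)) (Y1 (Y0 z) - Y0 (Y0 z)).
have := sqrt_iter_le n.+1 (Y1 z - Y0 z).
have := IHn (Y0 z); rewrite -/Y1 -/Y0.
have := IHn z; rewrite -/Y1 -/Y0.
have := sqrt_iter_le n z; rewrite -/Y0.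
have := sqrt_bound_mono n.
have [t0 t1] := andP (sqrt_bound_ge0_le1 n.+1).
have [s0 s1] := andP (sqrt_bound_ge0_le1 n).
have -> : sqrt_bound n.+2 = (1 + sqrt_bound n.+1 ^+ 2) / 2 by [].
have e1 : sqrt_bound n.+1 = (1 + sqrt_bound n ^+ 2) / 2 by [].
move: (nrm_ge0 z) e1 t0 t1 s0 s1.
move: (sqrt_bound n.+1) (sqrt_bound n) (nrm z) (nrm (Y0 z)) (nrm (Y1 z - Y0 z)).
move=> t s Z Y0z D Z0 e1 t0 t1 s0 s1 st le1 le2 le3 le4 le5.
have := ler_wpM2l t0 le2.
have : 0 <= t - s by lra.
move=> ts; have := ler_wpM2l ts le1.
have : (1 + t ^+ 2) / 2 - t = (t + s) * (t - s) / 2 by rewrite [X in _ - X]e1; field.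
move=> -> h1 h2; lra.
Qed.

End SquareRootIteration.
End Adjointable.

Section SquareRoot.
Context {R : realType} {A : cstarAlgebraType R}.
Implicit Types (x y z : A) (G X M P : A -> A).

Lemma sqrt_iter_rate X : adj X X -> contraction X -> forall m n z, (n <= m)%N ->
  nrm (sqrt_iter X m z - sqrt_iter X n z) <= 2 * nrm z / n.+1%:R.
Proof.
move=> X_sa X_contr m n z le_nm.
suff : nrm (sqrt_iter X m z - sqrt_iter X n z) <=
       (sqrt_bound m - sqrt_bound n) * nrm z.
  move=> le1; apply: le_trans le1 _; rewrite mulrAC ler_wpM2r ?nrm_ge0 //.
  have := sqrt_bound_rate (R := R) n.
  have /andP[_] := sqrt_bound_ge0_le1 (R := R) m.
  by move: (2 / _) => r; lra.
elim: m le_nm => [|m IHm]; first by rewrite leqn0 => /eqP ->; rewrite !subrr nrm0 mul0r.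
rewrite leq_eqVlt => /predU1P[->|/IHm le_m]; first by rewrite !subrr nrm0 mul0r.
have := sqrt_iter_step X_sa X_contr m z.
have := nrmDB (sqrt_iter X m.+1 z) (sqrt_iter X m z) (sqrt_iter X n z).
by move: le_m; rewrite !mulrBl; lra.
Qed.

Lemma sqrt_iter_comm X G G' : adj G G' -> (forall z, G (X z) = X (G z)) ->
  forall n z, G (sqrt_iter X n z) = sqrt_iter X n (G z).
Proof.
move=> GG' GX; elim=> [|n IHn] z /=.
  by rewrite -(scale0r 0) (adjE GG') !scale0r.
by rewrite !(adjE GG') GX !IHn.
Qed.

(** [K] is the limit of [1 - sqrt_iter X n]. The last two conclusions serve to
    take the square root of a square root and to have both commute with the
    operator that they come from, as in [starM_sqrt]. *)
Lemma sqrt_one_minus X : adj X X -> contraction X ->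
  exists K : A -> A, [/\ adj K K,
    forall z, K (K z) = z - X z,
    forall z, nrm (z - K z) <= nrm z &
    forall G G', adj G G' -> contraction G ->
      (forall z, G (X z) = X (G z)) -> forall z, G (K z) = K (G z)].
Proof.
move=> X_sa X_contr.
have [Y HY] : exists Y : A -> A, forall z n,
    nrm (sqrt_iter X n z - Y z) <= 2 * nrm z / n.+1%:R.
  have /boolp.choice[Y HY] z := cvg_rate (fun m n =>
    @sqrt_iter_rate X X_sa X_contr m n z).
  by exists Y.
have Yn_sa := sqrt_iter_sa X_sa.
have Y_sa : adj Y Y.
  move=> x y; apply/eqP; rewrite -subr_eq0; apply/eqP.
  apply: (@nrm_rate0 _ _ _ (4 * nrm x * nrm y)) => n.
  have -> : ip (Y x) y - ip x (Y y) =
      ip x (sqrt_iter X n y - Y y) - ip (sqrt_iter X n x - Y x) y.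
    by rewrite !ipE Yn_sa; clin.
  have := nrmB (ip x (sqrt_iter X n y - Y y)) (ip (sqrt_iter X n x - Y x) y).
  have := nrm_ip x (sqrt_iter X n y - Y y).
  have := nrm_ip (sqrt_iter X n x - Y x) y.
  have := ler_wpM2r (nrm_ge0 y) (HY x n).
  have := ler_wpM2l (nrm_ge0 x) (HY y n).
  move: (n.+1%:R^-1 : R) => r; lra.
have Y_contr : contraction Y.
  move=> z; apply: (@le_rate _ _ _ (2 * nrm z)) => n.
  have := HY z n; rewrite nrm_sub => h.
  have := nrm_leD (Y z) (sqrt_iter X n z).
  have := sqrt_iter_le X_contr n z.
  have /andP[_ /(ler_wpM2r (nrm_ge0 z))] := sqrt_bound_ge0_le1 (R := R) n.
  move: h; move: (_ / _) => r; lra.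
have Y_eq z : Y z = 2^-1%:C *: (X z + Y (Y z)).
  apply/eqP; rewrite -subr_eq0; apply/eqP.
  apply: (@nrm_rate0 _ _ _ (4 * nrm z)) => n.
  have -> : Y z - 2^-1%:C *: (X z + Y (Y z)) =
      2^-1%:C *: (sqrt_iter X n (sqrt_iter X n z - Y z) +
         (sqrt_iter X n (Y z) - Y (Y z))) - (sqrt_iter X n.+1 z - Y z).
    by rewrite !(adjE (Yn_sa n)) /=; clin.
  set u := sqrt_iter X n _ + _; set v := _ - Y z.
  have := nrmB (2^-1%:C *: u) v; rewrite nrmZr // => h.
  apply: le_trans h _.
  have := nrmD (sqrt_iter X n (sqrt_iter X n z - Y z)) (sqrt_iter X n (Y z) - Y (Y z)).
  have := sqrt_iter_le X_contr n (sqrt_iter X n z - Y z).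
  have /andP[_ /(ler_wpM2r (nrm_ge0 (sqrt_iter X n z - Y z)))] :=
    sqrt_bound_ge0_le1 (R := R) n.
  have := HY z n; have := HY (Y z) n; have := HY z n.+1; rewrite -/u -/v.
  have n1 : 0 <= n.+1%:R^-1 :> R by rewrite invr_ge0.
  have n2 : n.+2%:R^-1 <= n.+1%:R^-1 :> R by rewrite lef_pV2 ?posrE ?ltr0n // ler_nat.
  have := ler_wpM2r n1 (Y_contr z).
  have := ler_wpM2l (nrm_ge0 z) n2.
  move: (n.+1%:R^-1 : R) (n.+2%:R^-1 : R) n1 n2 => r s; lra.
exists (fun z => z - Y z); split.
- by move=> x y; rewrite !ipE Y_sa.
- move=> z; rewrite !(adjE Y_sa); have := Y_eq z.
  move=> /(congr1 (fun y => 2%:C *: y)) e.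
  have -> : Y (Y z) = 2%:C *: Y z - X z by rewrite e; clin.
  by clin.
- by move=> z; rewrite opprB addrC subrK.
- move=> G G' GG' G_contr GX z; rewrite !(adjE GG'); congr (_ - _).
  apply/eqP; rewrite -subr_eq0; apply/eqP.
  apply: (@nrm_rate0 _ _ _ (4 * nrm z)) => n.
  have -> : G (Y z) - Y (G z) =
      (sqrt_iter X n (G z) - Y (G z)) - G (sqrt_iter X n z - Y z).
    by rewrite !(adjE GG') (sqrt_iter_comm GG' GX); clin.
  set u := _ - Y (G z); set v := sqrt_iter X n z - _.
  have := nrmB u (G v); have := G_contr v; have := HY z n; have := HY (G z) n.
  have n1 : 0 <= n.+1%:R^-1 :> R by rewrite invr_ge0.
  have := ler_wpM2r n1 (G_contr z).
  rewrite -/u -/v; move: (n.+1%:R^-1 : R) n1 => r; lra.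
Qed.

Lemma sqrt_op P : adj P P -> (forall z, nrm (z - P z) <= nrm z) ->
  exists Q : A -> A, [/\ adj Q Q,
    forall z, Q (Q z) = P z,
    forall z, nrm (z - Q z) <= nrm z &
    forall G G', adj G G' -> contraction G ->
      (forall z, G (P z) = P (G z)) -> forall z, G (Q z) = Q (G z)].
Proof.
move=> P_sa P_contr.
have X_sa : adj (fun z => z - P z) (fun z => z - P z).
  by move=> x y; rewrite !ipE P_sa.
have [Q [Q_sa QQ Q_contr QG]] := sqrt_one_minus X_sa P_contr.
exists Q; split=> // [z|G G' GG' G_contr GP z]; first by rewrite QQ opprB addrC subrK.
by apply: (QG G G' GG' G_contr) => y; rewrite !(adjE GG') GP.
Qed.

(** With [K] the square root of [1 - M^2], the operator [K + iM] is unitary;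
    hence [K] is a contraction, and so is [K^2 = 1 - M^2]. *)
Lemma contraction_one_minus_sq M : adj M M -> contraction M ->
  forall z, nrm (z - M (M z)) <= nrm z.
Proof.
move=> M_sa M_contr z.
have MM_sa : adj (M \o M) (M \o M) by apply: adj_comp.
have [|K [K_sa KK _ /(_ M M M_sa M_contr) KM]] := sqrt_one_minus MM_sa.
  by move=> y /=; apply: le_trans (M_contr _) (M_contr _).
have K_contr : contraction K.
  move=> y; rewrite -ler_sqr ?nnegrE ?nrm_ge0 //.
  have : ip (K y) (M y) = ip (M y) (K y) by rewrite K_sa M_sa KM.
  move=> /normal_le le1; apply: le_trans le1 _.
  by rewrite K_sa M_sa KK -ipDr subrK nrm_ipxx.
by rewrite -KK; apply: le_trans (K_contr _) (K_contr _).
Qed.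

End SquareRoot.

(** * Positivity of c^* c *)

Section Positivity.
Context {R : realType} {A : cstarAlgebraType R}.
Implicit Types (a b c z : A) (D W : A -> A).

(** The core of the Kelley-Vaught theorem. Let [D = X + iY] with [X] and [Y]
    selfadjoint. Then [D D' = 2X^2 + 2Y^2 - D'D = 2X^2 + 2Y^2 + W^2] is
    positive, although its nonzero spectrum should be that of [D'D], which is
    negative. To see the conflict without spectra, put [e = (1 - W^2) D'] and
    [p = D D']. As [1 - W^2] is a contraction, [|e z| <= |D' z|] for all [z];
    but [D W^2 = - p D], so that [e^* e = (1 + p)^2 p], compared with
    [(D')^* D' = p]. The excess of the former over the latter bounds [p]. *)
Lemma adj_halving D D' W : adj D D' -> adj W W ->
  (forall z, D' (D z) = - W (W z)) -> contraction D ->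
  forall z, nrm (D z) <= 2^-1 * nrm z.
Proof.
move=> DD' W_sa D'D D_contr.
have D'_contr := adj_contraction DD' D_contr.
have D'Da := adj_sym DD'.
have W_contr : contraction W.
  move=> z; rewrite -ler_sqr ?nnegrE ?nrm_ge0 //.
  have : nrm (D z) ^+ 2 <= nrm z ^+ 2 by rewrite ler_sqr ?nnegrE ?nrm_ge0.
  by rewrite (adj_sq W_sa) (adj_sq DD') D'D ipNr nrmN.
pose X z := 2^-1%:C *: (D z + D' z).
pose Y z := (2^-1%:C * 'i) *: (D' z - D z).
have X_sa : adj X X by move=> x y; rewrite /X !ipE DD' D'Da; clin.
have Y_sa : adj Y Y by move=> x y; rewrite /Y !ipE DD' D'Da; clin.
have X_contr : contraction X.
  move=> z; rewrite nrmZr //; have := nrmD (D z) (D' z).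
  by have := D_contr z; have := D'_contr z; lra.
have Y_contr : contraction Y.
  move=> z; rewrite /Y -scalerA nrmZr // nrmi; have := nrmB (D' z) (D z).
  by have := D_contr z; have := D'_contr z; lra.
(* [D D' = 9 P]: dividing by [9] makes [1 - P] a mean of contractions, and as
   a square [9] allows [(1 + 9 Q^2)^2 = (1 - 9 Q^2)^2 + (6 Q)^2] below. *)
pose P z := 9^-1%:C *: D (D' z).
have P_sa : adj P P by move=> x y; rewrite /P !ipE DD' D'Da; clin.
have P_contr z : nrm (z - P z) <= nrm z.
  have -> : z - P z = 9^-1%:C *: (2%:C *: (z - X (X z)) + 2%:C *: (z - Y (Y z))
      + (z - W (W z)) + 4%:C *: z).
    have -> : W (W z) = - D' (D z) by rewrite D'D opprK.
    by rewrite /P /X /Y !(adjE DD') !(adjE D'Da); clin.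
  rewrite nrmZr //; set x := z - X _; set y := z - Y _; set w := z - W _.
  have := nrmD (2%:C *: x + 2%:C *: y + w) (4%:C *: z).
  have := nrmD (2%:C *: x + 2%:C *: y) w.
  have := nrmD (2%:C *: x) (2%:C *: y).
  rewrite !nrmZr //.
  have := contraction_one_minus_sq X_sa X_contr z.
  have := contraction_one_minus_sq Y_sa Y_contr z.
  have := contraction_one_minus_sq W_sa W_contr z.
  rewrite -/x -/y -/w; lra.
have [Q [Q_sa QQ _ _]] := sqrt_op P_sa P_contr.
have DD'E z : D (D' z) = 9%:C *: Q (Q z) by rewrite QQ /P; clin.
have D'_nrm z : nrm (D' z) ^+ 2 = 9 * nrm (Q z) ^+ 2.
  by rewrite (adj_sq D'Da) (adj_sq Q_sa) DD'E ipZr nrmZr.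
have D'_half z : nrm (D' z) <= 2^-1 * nrm z.
  set v := Q z.
  have le_v : nrm (v + 9%:C *: Q (Q v)) <= nrm v.
    pose e := D' z - W (W (D' z)).
    have le_e : nrm e <= nrm (D' z) by apply: contraction_one_minus_sq.
    have e_nrm : nrm e ^+ 2 = 9 * nrm (v + 9%:C *: Q (Q v)) ^+ 2.
      rewrite -!nrm_ipxx -nrmZr //; congr nrm.
      have -> : e = D' (z + D (D' z)).
        by rewrite /e (adjE D'Da) D'D.
      have -> : v + 9%:C *: Q (Q v) = Q (z + D (D' z)).
        by rewrite DD'E !(adjE Q_sa).
      by rewrite D'Da (DD'E (z + _)) ipZr Q_sa.
    have : nrm e ^+ 2 <= nrm (D' z) ^+ 2 by rewrite ler_sqr ?nnegrE ?nrm_ge0.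
    by rewrite e_nrm D'_nrm ler_pM2l // ler_sqr ?nnegrE ?nrm_ge0.
  have le_Qv : 6 * nrm (Q v) <= nrm (v + 9%:C *: Q (Q v)).
    rewrite -ler_sqr ?nnegrE ?mulr_ge0 ?nrm_ge0 // -nrmZr //.
    have : ip (6%:C *: Q v) (v - 9%:C *: Q (Q v)) =
           ip (v - 9%:C *: Q (Q v)) (6%:C *: Q v).
      by rewrite !ipE !Q_sa; clin.
    move=> /normal_le le1; apply: le_trans le1 _; rewrite -nrm_ipxx le_eqVlt.
    by apply/orP; left; apply/eqP; congr nrm; rewrite !ipE !Q_sa; clin.
  have [->|/nrm_gt0 z0] := pselect (D' z = 0).
    by rewrite nrm0 mulr_ge0 ?nrm_ge0.
  rewrite -(ler_pM2r z0) -expr2.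
  have le1 : nrm (D' z) ^+ 2 <= nrm z * nrm (D (D' z)).
    by rewrite (adj_sq D'Da) nrm_ip.
  have le2 : nrm (D (D' z)) <= 2^-1 * nrm (D' z).
    rewrite -ler_sqr ?nnegrE ?mulr_ge0 ?nrm_ge0 // exprMn D'_nrm.
    rewrite DD'E nrmZr // -/v.
    have := nrm_ge0 (Q v); have := nrm_ge0 v; nra.
  have := ler_wpM2l (nrm_ge0 z) le2; lra.
move=> z; have [->|/nrm_gt0 z0] := pselect (D z = 0).
  by rewrite nrm0 mulr_ge0 ?nrm_ge0.
rewrite -(ler_pM2r z0) -expr2 (adj_sq DD').
have := nrm_ip z (D' (D z)).
have := ler_wpM2l (nrm_ge0 z) (D'_half (D z)); lra.
Qed.

(** [adj_halving] applies again to [2D], [2D'] and [2W]. *)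
Lemma adj_neg_sq_eq0 D D' W : adj D D' -> adj W W ->
  (forall z, D' (D z) = - W (W z)) -> contraction D ->
  forall z, D z = 0.
Proof.
move=> DD' W_sa D'D D_contr z.
have iter n : forall D D' W : A -> A, adj D D' -> adj W W ->
    (forall z, D' (D z) = - W (W z)) -> contraction D ->
    nrm (D z) <= (2^-1) ^+ n * nrm z.
  elim: n => [|n IHn] {DD' W_sa D'D D_contr}D {}D' {}W DD' W_sa D'D D_contr.
    by rewrite mul1r.
  have := IHn (fun y => 2%:C *: D y) (fun y => 2%:C *: D' y) (fun y => 2%:C *: W y).
  rewrite nrmZr // exprS -mulrA; move=> H.
  have := adj_halving DD' W_sa D'D D_contr.
  rewrite -ler_pdivrMl ?invr_gt0 // invrK => half.
  apply: H => [x y|x y|y|y]; rewrite ?ipE ?DD' ?W_sa.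
  - by clin.
  - by clin.
  - by rewrite (adjE (adj_sym DD')) (adjE W_sa) D'D; clin.
  - by rewrite nrmZr //; have := half y; lra.
apply: (@nrm_rate0 _ _ _ (nrm z)) => n.
apply: le_trans (iter n _ _ _ DD' W_sa D'D D_contr) _.
rewrite mulrC ler_wpM2l ?nrm_ge0 // exprVn lef_pV2 ?posrE ?ltr0n ?exprn_gt0 //.
by rewrite -natrX ler_nat ltn_expl.
Qed.

(** Let [H] be the multiplication by [c^* c], [B = |H|] the square root of
    [H^2] and [N = (B - H) / 2] the negative part of [H]. Then [D = c N] has
    [D^* D = N H N = - B N^2], the opposite of a square; hence [D = 0], so
    [N = 0] and [H = B] has a square root. *)
Lemma starM_sqrt c : nrm c <= 1 ->
  exists Q : A -> A, adj Q Q /\ forall z, Q (Q z) = cmul (cmul (cstar c) c) z.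
Proof.
move=> c1; have c'1 : nrm (cstar c) <= 1 by rewrite nrm_star.
have mul_contr b : nrm b <= 1 -> contraction (cmul b).
  move=> b1 z; apply: le_trans (nrmM _ _) _.
  by rewrite -[leRHS]mul1r ler_wpM2r ?nrm_ge0.
pose H z := cmul (cstar c) (cmul c z).
have H_sa : adj H H by move=> x y; rewrite /H /ip !cstarM cstarK !cmulA.
have H_contr : contraction H.
  by move=> z; apply: le_trans (mul_contr _ c'1 _) (mul_contr _ c1 _).
have HH_sa : adj (H \o H) (H \o H) by apply: adj_comp.
have [B [B_sa BB B1 B_comm]] := sqrt_op HH_sa (contraction_one_minus_sq H_sa H_contr).
have HB := B_comm H H H_sa H_contr (fun z => erefl).
have [Q [Q_sa QQ _ Q_comm]] := sqrt_op B_sa B1.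
have HQ := Q_comm H H H_sa H_contr HB.
have B_contr : contraction B.
  move=> z; suff -> : nrm (B z) = nrm (H z) by exact: H_contr.
  apply/eqP; rewrite -(@eqrXn2 _ 2) ?nrm_ge0 //.
  by rewrite (adj_sq H_sa) (adj_sq B_sa) BB.
pose N z := 2^-1%:C *: (B z - H z).
have N_sa : adj N N by move=> x y; rewrite /N !ipE B_sa H_sa; clin.
have N_contr : contraction N.
  move=> z; rewrite nrmZr //; have := nrmB (B z) (H z).
  by have := B_contr z; have := H_contr z; lra.
have QN z : Q (N z) = N (Q z).
  by rewrite /N !(adjE Q_sa) -!HQ -!QQ.
have HN z : H (N z) = - B (N z).
  by rewrite /N !(adjE H_sa) !(adjE B_sa) HB -[H (H z)]/((H \o H) z) -BB; clin.
have DN0 : forall z, cmul c (N z) = 0.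
  apply: (@adj_neg_sq_eq0 _ (fun z => N (cmul (cstar c) z)) (Q \o N)).
  - by move=> x y; rewrite adj_mul N_sa.
  - by move=> x y /=; rewrite Q_sa N_sa QN.
  - by move=> z; rewrite -[cmul _ (cmul _ _)]/(H (N z)) HN (adjE N_sa) /= QN QQ.
  - by move=> z; apply: le_trans (mul_contr _ c1 _) (N_contr _).
have BH z : B z = H z.
  have HN0 : H (N z) = 0 by rewrite /H DN0 cmul0r.
  have BN0 : B (N z) = 0 by rewrite -[B _]opprK -HN HN0 oppr0.
  have : nrm (N z) ^+ 2 = 0.
    by rewrite (adj_sq N_sa) [N (N z)]/N HN0 BN0 subrr scaler0 /ip cmul0r nrm0.
  move=> /eqP; rewrite sqrf_eq0 => /eqP /nrm0_eq0 Nz0.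
  have -> : B z = 2%:C *: N z + H z by rewrite /N; clin.
  by rewrite Nz0 scaler0 add0r.
by exists Q; split=> // z; rewrite QQ BH /H cmulA.
Qed.

(** The norm is monotone on positive elements. By scaling and symmetry it is
    enough to bound [|h + k|] from below for [h = a^* a = G^2] of norm [1] and
    [k = b^* b] of norm at most [1]. Then [1 + h = (1 - k) + (h + k)], where
    [1 - k] is a contraction, while [2 |G v| <= |(1 + G^2) v|] for all [v]. *)
Lemma nrm_starM_leD a b : nrm a ^+ 2 <= nrm (cmul (cstar a) a + cmul (cstar b) b).
Proof.
have unit_case (a0 b0 : A) : nrm a0 = 1 -> nrm b0 <= 1 ->
    1 <= nrm (cmul (cstar a0) a0 + cmul (cstar b0) b0).
  move=> a1 b1; set h := cmul _ a0; set k := cmul _ b0; set p := nrm _.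
  have [G [G_sa GG]] : exists Q, adj Q Q /\ forall z, Q (Q z) = cmul h z.
    by apply: starM_sqrt; rewrite a1.
  have [K [K_sa KK]] := starM_sqrt b1.
  have h1 : nrm h = 1 by rewrite nrm_starM a1 expr1n.
  have k1 : nrm k <= 1 by rewrite nrm_starM exprn_ile1 ?nrm_ge0.
  have K_contr : contraction K.
    move=> z; rewrite -ler_sqr ?nnegrE ?nrm_ge0 // (adj_sq K_sa) KK -/k.
    apply: le_trans (nrm_ip _ _) _.
    rewrite expr2 ler_wpM2l ?nrm_ge0 //.
    apply: le_trans (nrmM _ _) _.
    by rewrite -[leRHS]mul1r ler_wpM2r ?nrm_ge0.
  set v := G h.
  have le_v : nrm (v + G (G v)) <= (1 + p) * nrm v.
    have -> : v + G (G v) = (v - K (K v)) + cmul (h + k) v.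
      by rewrite GG KK cmulDl -/k; clin.
    apply: le_trans (nrmD _ _) _; rewrite mulrDl mul1r; apply: lerD.
      exact: contraction_one_minus_sq.
    exact: nrmM.
  have le_Gv : 2 * nrm (G v) <= nrm (v + G (G v)).
    rewrite -ler_sqr ?nnegrE ?mulr_ge0 ?nrm_ge0 // -nrmZr //.
    have : ip (2%:C *: G v) (v - G (G v)) = ip (v - G (G v)) (2%:C *: G v).
      by rewrite !ipE !G_sa; clin.
    move=> /normal_le le1; apply: le_trans le1 _; rewrite -nrm_ipxx le_eqVlt.
    by apply/orP; left; apply/eqP; congr nrm; rewrite !ipE !G_sa; clin.
  have Gv1 : nrm (G v) = 1.
    have h_sa : cstar h = h by rewrite /h cstarM cstarK.
    by rewrite /v GG -{1}h_sa nrm_starM h1 expr1n.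
  have v1 : nrm v <= 1.
    rewrite -ler_sqr ?nnegrE ?nrm_ge0 // (adj_sq G_sa) -/v expr1n.
    by apply: le_trans (nrm_ip _ _) _; rewrite h1 mul1r Gv1.
  have p0 : 0 <= p by apply: nrm_ge0.
  have := ler_wpM2l (addr_ge0 ler01 p0) v1.
  move: le_v le_Gv; rewrite Gv1; lra.
have scaled a0 b0 : nrm b0 <= nrm a0 ->
    nrm a0 ^+ 2 <= nrm (cmul (cstar a0) a0 + cmul (cstar b0) b0).
  move=> ba; have [->|/nrm_gt0 agt0] := pselect (a0 = 0).
    by rewrite nrm0 expr0n nrm_ge0.
  pose r := (nrm a0)^-1; have r0 : 0 < r by rewrite invr_gt0.
  have := unit_case (r%:C *: a0) (r%:C *: b0); rewrite !nrmZr ?(ltW r0) //.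
  rewrite mulVf ?gt_eqF // => /(_ erefl).
  have -> : r * nrm b0 <= 1 by rewrite ler_pdivrMl // mulr1.
  move=> /(_ isT).
  have -> : cmul (cstar (r%:C *: a0)) (r%:C *: a0) +
     cmul (cstar (r%:C *: b0)) (r%:C *: b0) =
     (r ^+ 2)%:C *: (cmul (cstar a0) a0 + cmul (cstar b0) b0).
    by rewrite !cstarZ !cmulZl !cmulZr; clin.
  by rewrite nrmZr ?sqr_ge0 // exprVn mulrC ler_pdivlMr ?exprn_gt0 // mul1r.
have [ba|/ltW ab] := leP (nrm b) (nrm a); first exact: scaled.
rewrite addrC; apply: le_trans (scaled _ _ ab).
by rewrite ler_sqr ?nnegrE ?nrm_ge0.
Qed.

End Positivity.

(** * Inner products in a Hilbert module *)

Section Inner.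
Context {R : realType} {A : cstarAlgebraType R} {E : hilbertModuleType A}.
Implicit Types (x y z u : E).

Lemma innerDl x y z : inner (x + y) z = inner x z + inner y z.
Proof. by rewrite -innerC innerDr cstarD !innerC. Qed.
Lemma innerZl (l : R[i]) x z : inner (l *: x) z = conjc l *: inner x z.
Proof. by rewrite -innerC innerZr cstarZ !innerC. Qed.
Lemma innerNr x z : inner z (- x) = - inner z x.
Proof. by rewrite -scaleN1r innerZr scaleN1r. Qed.
Lemma innerNl x z : inner (- x) z = - inner x z.
Proof.
apply/eqP; rewrite -addr_eq0 -innerDl addNr.
by apply/eqP/(addIr (inner 0 z)); rewrite -innerDl !add0r.
Qed.

Definition innerE :=
  (innerDl, @innerDr _ _ E, innerZl, @innerZr _ _ E, innerNl, innerNr).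

Lemma nrm_inner x : nrm (inner x x) = nrm x ^+ 2.
Proof.
have := inner_norm x; rewrite !nrmE -rmorphXn => /eqP.
by rewrite eq_complex => /andP[/eqP/esym].
Qed.

(** A Cauchy-Schwarz inequality up to a constant, from polarization and the
    triangle inequality; the constant does not matter in what follows. *)
Lemma nrm_inner_le x y : nrm (inner x y) <= 4 * nrm x * nrm y.
Proof.
have le_sq u v : nrm (inner u v) <= (nrm u + nrm v) ^+ 2.
  pose q (c : R[i]) := inner (u + c *: v) (u + c *: v).
  have -> : inner u v = 4^-1%:C *: (q 1 - 'i *: q 'i + (- q (- 1) + 'i *: q (- 'i))).
    by rewrite /q !innerE; clin.
  have q_le (c : R[i]) : Normc.normc c = 1 -> nrm (q c) <= (nrm u + nrm v) ^+ 2.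
    move=> c1; rewrite nrm_inner ler_sqr ?nnegrE ?addr_ge0 ?nrm_ge0 //.
    by apply: le_trans (nrmD _ _) _; rewrite nrmZ c1 mul1r.
  have n1 : Normc.normc (1 : R[i]) = 1 by rewrite /= expr1n expr0n addr0 sqrtr1.
  have n2 : Normc.normc ('i : R[i]) = 1 by rewrite /= expr1n expr0n add0r sqrtr1.
  have n3 : Normc.normc (- 1 : R[i]) = 1.
    by rewrite /= oppr0 sqrrN expr1n expr0n addr0 sqrtr1.
  have n4 : Normc.normc (- 'i : R[i]) = 1.
    by rewrite /= oppr0 sqrrN expr1n expr0n add0r sqrtr1.
  rewrite nrmZr //.
  have := nrmD (q 1 - 'i *: q 'i) (- q (- 1) + 'i *: q (- 'i)).
  have := nrmB (q 1) ('i *: q 'i).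
  have := nrmD (- q (- 1)) ('i *: q (- 'i)).
  rewrite !nrmi nrmN.
  by have := q_le _ n1; have := q_le _ n2; have := q_le _ n3; have := q_le _ n4; lra.
have [->|/nrm_gt0 x0] := pselect (x = 0).
  by rewrite -(scale0r 0) innerZl conjc0 !scale0r !nrm0 mulr0 mul0r.
have [->|/nrm_gt0 y0] := pselect (y = 0).
  by rewrite -(scale0r 0) innerZr !scale0r !nrm0 mulr0.
have := le_sq ((nrm x)^-1%:C *: x) ((nrm y)^-1%:C *: y).
rewrite innerZl innerZr conjc_real scalerA -rmorphM /=.
rewrite !nrmZr ?mulr_ge0 ?invr_ge0 ?nrm_ge0 //.
rewrite !mulVf ?gt_eqF // -invfM ler_pdivrMl ?mulr_gt0 //; lra.
Qed.

Lemma nrm_inner_leD x y : nrm x ^+ 2 <= nrm (inner x x + inner y y).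
Proof.
rewrite -nrm_inner; have [a ->] := inner_pos x; have [b ->] := inner_pos y.
by rewrite nrm_starM nrm_starM_leD.
Qed.

Lemma nrm_combination_le (a b : R) x y : 0 <= a -> 0 <= b ->
  nrm (a%:C *: x + b%:C *: y) ^+ 2 <=
  a ^+ 2 * nrm x ^+ 2 + b ^+ 2 * nrm y ^+ 2 + 2 * (a * b * nrm (inner x y)).
Proof.
move=> a0 b0; have ab0 := mulr_ge0 a0 b0; rewrite -nrm_inner.
have -> : inner (a%:C *: x + b%:C *: y) (a%:C *: x + b%:C *: y) =
    (a ^+ 2)%:C *: inner x x + (b ^+ 2)%:C *: inner y y +
    (a * b)%:C *: (inner x y + inner y x) by rewrite !innerE; clin.
have := nrmD ((a ^+ 2)%:C *: inner x x + (b ^+ 2)%:C *: inner y y)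
  ((a * b)%:C *: (inner x y + inner y x)).
have := nrmD ((a ^+ 2)%:C *: inner x x) ((b ^+ 2)%:C *: inner y y).
have := ler_wpM2l ab0 (nrmD (inner x y) (inner y x)).
rewrite -(innerC x y) nrm_star (nrmZr _ ab0) !(nrmZr _ (sqr_ge0 _)) !nrm_inner.
by rewrite innerC; lra.
Qed.

Lemma dense_inner_inj (D : set E) x y : dense D ->
  (forall u, D u -> inner u x = inner u y) -> x = y.
Proof.
move=> /dense_nrm dD eq_xy; apply/eqP; rewrite -subr_eq0; apply/eqP.
set z := x - y; apply/nrm0_eq0/eqP; rewrite -sqrf_eq0 -nrm_inner; apply/eqP.
suff -> : inner z z = 0 by rewrite nrm0.
apply: (@eq_of_nrm_le _ _ _ _ (4 * nrm z)) => e e0; rewrite subr0.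
have [u Du zu] := dD z e e0.
have -> : inner z z = inner (z - u) z.
  rewrite innerDl innerNl [inner u z](_ : _ = 0) ?subr0 //.
  by rewrite innerDr innerNr eq_xy // subrr.
apply: le_trans (nrm_inner_le _ _) _; rewrite mulrAC ler_wpM2l ?(ltW zu) //.
by rewrite mulr_ge0 ?nrm_ge0.
Qed.

End Inner.

(** * Symmetric operators and dense ranges *)

Section Symmetric.
Context {R : realType} {A : cstarAlgebraType R} {E : hilbertModuleType A}.
Context (D : set E) (D_sub : submodule D) (D_dense : dense D).
Implicit Types (x y z u : E) (L S T V W : E -> E) (m : R).

Definition linear_on L := (forall x y, D x -> D y -> L (x + y) = L x + L y) /\
  (forall (l : R[i]) x, D x -> L (l *: x) = l *: L x).

Definition symmetric_on S := forall x y, D x -> D y -> inner (S x) y = inner x (S y).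

Definition dense_range_on L :=
  forall y (e : R), 0 < e -> exists2 x, D x & nrm (y - L x) < e.

Definition shift S m x := S x + m*i *: x.

Lemma symmetric_linear S : symmetric_on S -> linear_on S.
Proof.
have [D0 DD DZ _] := D_sub; move=> sS; split=> [x y Dx Dy|l x Dx].
  apply: (dense_inner_inj D_dense) => u Du.
  by rewrite innerDr -!sS ?innerDr //; exact: DD.
apply: (dense_inner_inj D_dense) => u Du.
by rewrite innerZr -!sS ?innerZr //; exact: DZ.
Qed.

Lemma symmetric_shift_sq S m x : symmetric_on S -> D x ->
  inner (shift S m x) (shift S m x) =
  inner (S x) (S x) + inner (m%:C *: x) (m%:C *: x).
Proof. by move=> sS Dx; rewrite /shift !innerE (sS x x) //; clin. Qed.

Lemma symmetric_shift_le S m x : symmetric_on S -> D x ->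
  nrm (S x) <= nrm (shift S m x) /\ `|m| * nrm x <= nrm (shift S m x).
Proof.
move=> sS Dx; split; rewrite -ler_sqr ?nnegrE ?mulr_ge0 ?nrm_ge0 //.
  by rewrite -[leRHS]nrm_inner symmetric_shift_sq // nrm_inner_leD.
rewrite -[leRHS]nrm_inner symmetric_shift_sq // addrC -nrmZi.
have -> : nrm (m*i *: x) = nrm (m%:C *: x).
  by rewrite nrmZi nrmZ /= expr0n addr0 sqrtr_sqr.
exact: nrm_inner_leD.
Qed.

(** The Neumann series for [(1 + W L^-1)^-1], in an approximate form: solving
    [L u = r] for the current residual [r] up to a small error and adding [u]
    multiplies the residual by at most [(1 + th) / 2]. *)
Lemma dense_range_perturbation L W (th : R) :
  linear_on L -> linear_on W -> 0 <= th < 1 ->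
  (forall x, D x -> nrm (W x) <= th * nrm (L x)) ->
  dense_range_on L -> dense_range_on (fun x => L x + W x).
Proof.
have [D0 DD _ _] := D_sub.
move=> [LD _] [WD _] /andP[th0 th1] W_le L_dense y e e0.
pose q := (1 + th) / 2.
have geom n : exists2 x, D x & nrm (y - (L x + W x)) <= q ^+ n * nrm y.
  elim: n => [|n [x Dx IHx]].
    exists 0 => //; have L0 : L 0 = 0.
      by apply: (addIr (L 0)); rewrite -LD // !add0r.
    have W0 : W 0 = 0 by apply: (addIr (W 0)); rewrite -WD // !add0r.
    by rewrite L0 W0 addr0 subr0 mul1r.
  set r := y - (L x + W x) in IHx.
  suff [u Du le_u] : exists2 u, D u & nrm (r - (L u + W u)) <= q * nrm r.
    exists (x + u); first exact: DD.
    rewrite LD // WD //.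
    have -> : y - (L x + L u + (W x + W u)) = r - (L u + W u) by rewrite /r; clin.
    apply: le_trans le_u _; rewrite exprS -mulrA ler_wpM2l // /q; lra.
  have [r0|/nrm_gt0 r0] := pselect (r = 0).
    exists 0 => //; have L0 : L 0 = 0.
      by apply: (addIr (L 0)); rewrite -LD // !add0r.
    have W0 : W 0 = 0 by apply: (addIr (W 0)); rewrite -WD // !add0r.
    by rewrite L0 W0 r0 addr0 subr0 nrm0 mulr0.
  have eta0 : 0 < nrm r * (1 - th) / 4 by rewrite divr_gt0 // mulr_gt0 // subr_gt0.
  have [u Du ru] := L_dense r _ eta0; exists u => //.
  have -> : r - (L u + W u) = (r - L u) - W u by clin.
  have := nrmB (r - L u) (W u); have := W_le u Du.
  have := nrmDB (L u) r 0; rewrite !subr0 (nrm_sub (L u)) => h1 h2 h3.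
  have := ler_wpM2l th0 h1; have := ler_wpM2r (nrm_ge0 (r - L u)) (ltW th1).
  by rewrite /q; lra.
have q1 : `|q| < 1 by rewrite ger0_norm /q; lra.
have y1 : 0 < nrm y + 1 by rewrite ltr_wpDl ?nrm_ge0.
have /cvgrPdist_lt /(_ _ (divr_gt0 e0 y1))[N _ HN] := cvg_expr q1.
have [x Dx le_x] := geom N; exists x => //; apply: le_lt_trans le_x _.
have := HN N (leqnn N); rewrite /= sub0r normrN ltr_pdivlMr //.
have := ler_norm (q ^+ N); have := nrm_ge0 y; nra.
Qed.

Lemma linear_shift S m : linear_on S -> linear_on (shift S m).
Proof.
move=> [SD SZ]; split=> [x y Dx Dy|l x Dx]; rewrite /shift.
  by rewrite SD //; clin.
by rewrite SZ //; case: l => a b; clin.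
Qed.

Lemma dense_range_shift S m m' : symmetric_on S -> `|m' - m| < `|m| ->
  dense_range_on (shift S m) -> dense_range_on (shift S m').
Proof.
move=> sS lt_m S_dense y e e0.
have m0 : 0 < `|m| by apply: le_lt_trans lt_m.
have pert : dense_range_on (fun x => shift S m x + (m' - m)*i *: x).
  apply: (@dense_range_perturbation _ _ (`|m' - m| / `|m|)) S_dense.
  - exact/linear_shift/symmetric_linear.
  - by split=> [x z _ _|[a b] x _]; clin.
  - by rewrite divr_ge0 //= ltr_pdivrMr // mul1r.
  - move=> x Dx; rewrite nrmZi mulrAC ler_pdivlMr // -mulrA ler_wpM2l //.
    by rewrite mulrC; have [] := symmetric_shift_le m sS Dx.
have [x Dx lt_x] := pert y e e0.
exists x => //; rewrite (_ : shift S m' x = shift S m x + (m' - m)*i *: x) //.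
by rewrite /shift; clin.
Qed.

(** The limit case, relative bound [1], of [dense_range_perturbation]. For
    [t < 1] let [x] be an approximate solution of [(T + tV + im) x = y]. Its
    residual [s = y - (T + V + im) x] is [- (1 - t) V x] up to a small error.
    It stays bounded since [(1 - t) |V x| <= |(T + tV + im) x|], and tends
    weakly to [0] when [t] tends to [1]: for [u] in [D], the product [<u, s>]
    is about [- (1 - t) <V u, x>] and [|x|] is bounded, so [<r, s>] gets
    arbitrarily small for every [r] by density of [D]. Averaging one more
    residual of this kind with the previous average brings its squared norm
    from [K / n] below [K / (n + 1)], as in the Banach-Saks theorem. *)
Lemma dense_range_wuest T V m : m != 0 -> symmetric_on T -> symmetric_on V ->
  (forall x, D x -> nrm (V x) <= nrm (shift T m x)) ->
  dense_range_on (shift T m) -> dense_range_on (shift (fun x => T x + V x) m).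
Proof.
move=> m0 sT sV V_le T_dense y.
have [D0 DD DZ _] := D_sub.
have linT := symmetric_linear sT; have linV := symmetric_linear sV.
pose L := shift (fun x => T x + V x) m.
have linL : linear_on L.
  by apply: linear_shift; apply: symmetric_linear => x z Dx Dz; rewrite !innerE sT ?sV.
pose C := nrm y + 1; pose C' := C + 1; pose K := C' ^+ 2 + 1.
have C_ge1 : 1 <= C by rewrite lerDr nrm_ge0.
have am0 : 0 < `|m| by rewrite normr_gt0.
have approx t : 0 <= t < 1 -> exists x, [/\ D x, 
    nrm (y - (L x - (1 - t)%:C *: V x)) <= 1 - t,
    nrm x <= C / `|m| & (1 - t) * nrm (V x) <= C].
  move=> t01; have [t0 t1] := andP t01.
  have t'0 : 0 < 1 - t by rewrite subr_gt0.
  have pert : dense_range_on (fun x => shift T m x + t%:C *: V x).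
    apply: (@dense_range_perturbation _ _ t) T_dense => //.
    - exact: linear_shift.
    - have [VD VZ] := linV; split=> [x z Dx Dz|[a b] x Dx].
        by rewrite VD // scalerDr.
      by rewrite VZ //; clin.
    - by move=> x Dx; rewrite nrmZr // ler_wpM2l // V_le.
  have [x Dx lt_x] := pert y _ t'0.
  have LE : shift T m x + t%:C *: V x = L x - (1 - t)%:C *: V x.
    by rewrite /L /shift; clin.
  have xE : shift T m x + t%:C *: V x = shift (fun x => T x + t%:C *: V x) m x.
    by rewrite /shift; clin.
  have sTV : symmetric_on (fun x => T x + t%:C *: V x).
    by move=> u v Du Dv; rewrite !innerE sT ?sV //; clin.
  have le_C : nrm (shift T m x + t%:C *: V x) <= C.
    have := nrm_leD (shift T m x + t%:C *: V x) y.
    by rewrite nrm_sub /C; lra.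
  exists x; split=> //.
  - by rewrite -LE ltW.
  - rewrite ler_pdivlMr // mulrC; apply: le_trans le_C; rewrite xE.
    by have [] := symmetric_shift_le m sTV Dx.
  - have := nrmB (shift T m x + t%:C *: V x) (t%:C *: V x); rewrite addrK nrmZr //.
    by have := V_le x Dx; lra.
have weak r (e : R) : 0 < e -> exists x, [/\ D x, nrm (y - L x) <= C' &
    nrm (inner r (y - L x)) <= e].
  move=> e0; pose d := e / (4 * C' + 1).
  have d0 : 0 < d by rewrite divr_gt0 // /C'; lra.
  have [u Du ru] := (dense_nrm D).1 D_dense r d d0.
  pose B := 4 * nrm u + 4 * nrm (V u) * (C / `|m|).
  have CM0 : 0 <= C / `|m| by rewrite divr_ge0 //; lra.
  have B0 : 0 <= B.
    by apply: addr_ge0; [|apply: mulr_ge0 => //]; rewrite mulr_ge0 ?nrm_ge0.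
  have Bd0 : 0 < B + d by rewrite ltr_wpDl.
  (* [tau] is [1 - t]. *)
  pose tau := d / (B + d).
  have tau0 : 0 < tau by rewrite divr_gt0.
  have tau1 : tau <= 1 by rewrite ler_pdivrMr // mul1r lerDr.
  have tauB : tau * B <= d.
    by rewrite /tau mulrAC ler_pdivrMr // ler_wpM2l ?(ltW d0) // lerDl ltW.
  have [|x [Dx]] := approx (1 - tau); first by rewrite subr_ge0 tau1 gtrBl.
  rewrite subKr; set eps := y - _ => le_eps le_x le_Vx.
  have resE : y - L x = eps - tau%:C *: V x by rewrite /eps; clin.
  exists x; split=> //.
    rewrite resE; have := nrmB eps (tau%:C *: V x).
    by rewrite nrmZr ?(ltW tau0) // /C'; lra.
  set s := y - L x.
  have s_le : nrm s <= C'.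
    rewrite /s resE; have := nrmB eps (tau%:C *: V x).
    by rewrite nrmZr ?(ltW tau0) // /C'; lra.
  have -> : inner r s = inner (r - u) s + (inner u eps - tau%:C *: inner (V u) x).
    by rewrite sV // /s resE !innerE; clin.
  have := nrmD (inner (r - u) s) (inner u eps - tau%:C *: inner (V u) x).
  have := nrmB (inner u eps) (tau%:C *: inner (V u) x).
  rewrite nrmZr ?(ltW tau0) //.
  have := nrm_inner_le (r - u) s.
  have := nrm_inner_le u eps.
  have := ler_wpM2l (ltW tau0) (nrm_inner_le (V u) x).
  have u0 : 0 <= 4 * nrm u by rewrite mulr_ge0 ?nrm_ge0.
  have := ler_wpM2l u0 le_eps.
  have Vu0 : 0 <= tau * (4 * nrm (V u)).
    by apply: mulr_ge0; [exact: ltW|rewrite mulr_ge0 ?nrm_ge0].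
  have := ler_wpM2l Vu0 le_x.
  have := ler_wpM2l (nrm_ge0 (r - u)) s_le.
  have C'0 : 0 <= C' by rewrite /C'; lra.
  have := ler_wpM2r C'0 (ltW ru).
  have eE : e = 4 * (d * C') + d by rewrite /d; field; rewrite /C'; lra.
  move: tauB; rewrite /B mulrDr; rewrite eE; lra.
have C'0 : 0 <= C' by rewrite /C'; lra.
have conv n : exists2 x, D x & nrm (y - L x) ^+ 2 <= K / n.+1%:R.
  elim: n => [|n [x Dx le_x]].
    have [x [Dx le_x _]] := weak 0 1 ltr01; exists x => //.
    rewrite divr1; apply: (@le_trans _ _ (C' ^+ 2)); last by rewrite lerDl.
    by rewrite ler_sqr ?nnegrE ?nrm_ge0.
  have N0 : 0 < n.+1%:R :> R by rewrite ltr0n.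
  have e0 : 0 < (2 * n.+1%:R)^-1 :> R by rewrite invr_gt0 mulr_gt0.
  have [z [Dz le_z le_xz]] := weak (y - L x) _ e0.
  move: le_x le_xz; rewrite -[n.+2]addn1 natrD.
  move: (n.+1%:R : R) N0 {e0} => N N0 le_x le_xz.
  have N1 : 0 < N + 1 by rewrite addr_gt0.
  pose a := N / (N + 1); pose b := (N + 1)^-1.
  have a0 : 0 <= a by rewrite divr_ge0 // ltW.
  have b0 : 0 <= b by rewrite invr_ge0 ltW.
  exists (a%:C *: x + b%:C *: z); first by apply: DD; apply: DZ.
  have [LD LZ] := linL; rewrite LD ?LZ //; try exact: DZ.
  set r := y - L x in le_x le_xz; set s := y - L z in le_z le_xz.
  have -> : y - (a%:C *: L x + b%:C *: L z) = a%:C *: r + b%:C *: s.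
    have ab : a%:C + b%:C = 1 :> R[i].
      by rewrite -rmorphD (_ : a + b = 1) // /a /b; field; rewrite gt_eqF.
    by rewrite -[y in LHS]scale1r -ab /r /s; clin.
  have := nrm_combination_le r s a0 b0 => h1.
  have s2 : nrm s ^+ 2 <= C' ^+ 2 by rewrite ler_sqr ?nnegrE ?nrm_ge0.
  have := ler_wpM2l (sqr_ge0 a) le_x.
  have := ler_wpM2l (sqr_ge0 b) s2.
  have ab0 := mulr_ge0 a0 b0.
  have := ler_wpM2l ab0 le_xz.
  have <- : a ^+ 2 * (K / N) + b ^+ 2 * C' ^+ 2 + 2 * (a * b * (2 * N)^-1) = K / (N + 1).
    by rewrite /a /b /K; field; rewrite !gt_eqF.
  lra.
move=> e e0; have e2 : 0 < e ^+ 2 by rewrite exprn_gt0.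
have [x Dx le_x] := conv (Num.trunc (K / e ^+ 2)); exists x => //.
rewrite -ltr_sqr ?nnegrE ?nrm_ge0 ?ltW //; apply: le_lt_trans le_x _.
by rewrite ltr_pdivrMr ?ltr0Sn // mulrC -ltr_pdivrMr // truncnS_gt.
Qed.

End Symmetric.

(** * Closures, selfadjointness and regularity *)

Section Closure.
Context {R : realType} {V W : completeNormedModType R[i]}.

Lemma closure_nrm (G : set (V * W)) (x : V) (z : W) : closure G (x, z) <->
  forall e : R, 0 < e -> exists p, [/\ G p, nrm (p.1 - x) <= e & nrm (p.2 - z) <= e].
Proof.
split=> [cG e e0|H B [[P Q] [/= Px Qz] PQB]].
  have e0C : 0 < e%:C by rewrite ltcR.
  have [p [Gp [/= xp zp]]] : G `&` (ball x e%:C `*` ball z e%:C) !=set0.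
    by apply: cG; exists (ball x e%:C, ball z e%:C) => //; split; exact: nbhsx_ballx.
  exists p; split=> //.
    by move: xp; rewrite -ball_normE /ball_ /= nrmE ltcR nrm_sub => /ltW.
  by move: zp; rewrite -ball_normE /ball_ /= nrmE ltcR nrm_sub => /ltW.
have [/= a a0 aP] := nbhs_nrm Px; have [/= b b0 bQ] := nbhs_nrm Qz.
have ab0 : 0 < Num.min a b / 2 by rewrite divr_gt0 // lt_min a0.
have [p [Gp p1 p2]] := H _ ab0; exists p; split=> //; apply: PQB; split.
  by apply: aP; apply: le_lt_trans p1 _; have := ge_min a a b; rewrite lexx /=; lra.
by apply: bQ; apply: le_lt_trans p2 _; have := ge_min b a b; rewrite lexx orbT /=; lra.
Qed.

End Closure.

Section AdjointValues.
Context {R : realType} {A : cstarAlgebraType R} {E : hilbertModuleType A}.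
Implicit Types (T : operator E) (y z : E).

Lemma adjoint_value_unique T y z z' : dense (dom T) ->
  is_adjoint_value T y z -> is_adjoint_value T y z' -> z = z'.
Proof.
by move=> dT Hz Hz'; apply: (dense_inner_inj dT) => u Tu; rewrite -Hz // Hz'.
Qed.

Lemma adjoint_valueP T y z : dense (dom T) ->
  is_adjoint_value T y z -> dom (adjoint T) y /\ adjoint T y = z.
Proof.
move=> dT yz; have yd : dom (adjoint T) y by exists z.
split=> //; apply: (@adjoint_value_unique T y) => //.
by have := @xgetPex _ 0 [set z | is_adjoint_value T y z] yd.
Qed.

Lemma adjoint_value T y : dom (adjoint T) y ->
  is_adjoint_value T y (adjoint T y).
Proof. by move=> yd; exact: (@xgetPex _ 0 [set z | is_adjoint_value T y z] yd). Qed.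

End AdjointValues.

(** A symmetric [S] for which both [S + i] and [S - i] have dense range is
    essentially selfadjoint with regular closure; the closure is its adjoint. *)
Section Essential.
Context {R : realType} {A : cstarAlgebraType R} {E : hilbertModuleType A}.
Context (D : set E) (D_sub : submodule D) (D_dense : dense D).
Context (S : E -> E) (S_sym : symmetric_on D S).
Context (S_p : dense_range_on D (shift S 1)) (S_m : dense_range_on D (shift S (- 1))).
Implicit Types (x y z u w : E).

Let S0 := Operator D S.
Let Sa := adjoint S0.

Let graph_limit x z := forall e : R, 0 < e ->
  exists u, [/\ D u, nrm (u - x) <= e & nrm (S u - z) <= e].

Lemma graph_limit_adjoint x z : graph_limit x z -> is_adjoint_value S0 x z.
Proof.
move=> xz v /= Dv; apply: (@eq_of_nrm_le _ _ _ _ (4 * nrm (S v) + 4 * nrm v)) => e e0.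
have [u [Du ux uz]] := xz e e0.
have -> : inner (S v) x - inner v z = inner v (S u - z) - inner (S v) (u - x).
  by rewrite !innerE (S_sym Dv Du); clin.
have := nrmB (inner v (S u - z)) (inner (S v) (u - x)).
have := nrm_inner_le v (S u - z); have := nrm_inner_le (S v) (u - x).
have v0 : 0 <= 4 * nrm v by rewrite mulr_ge0 ?nrm_ge0.
have Sv0 : 0 <= 4 * nrm (S v) by rewrite mulr_ge0 ?nrm_ge0.
have := ler_wpM2l v0 uz; have := ler_wpM2l Sv0 ux; lra.
Qed.

(** Take [u] with [(S + i) u] close to [z + ix]. Then [q = u - x] is small
    because it is almost orthogonal to the range of [S - i], which is dense. *)
Lemma adjoint_graph_limit x z : is_adjoint_value S0 x z -> graph_limit x z.
Proof.
move=> xz e e0; pose d := e / 8.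
have d0 : 0 < d by rewrite divr_gt0.
have [u Du] := S_p (z + 'i *: x) d0; rewrite nrm_sub /shift.
set r := S u + _ - _ => r_le.
have rE w : D w -> inner (shift S (- 1) w) (u - x) = inner w r.
  move=> Dw; rewrite /shift /r !innerE (S_sym Dw Du) [inner (S w) x](xz w Dw).
  by clin.
have ux : nrm (u - x) <= 4 * d.
  have [->|/nrm_gt0 ux0] := pselect (u - x = 0); first by rewrite nrm0 mulr_ge0 ?ltW.
  rewrite -(ler_pM2r ux0) -expr2 -nrm_inner.
  apply: (@le_rate _ _ _ (4 * d + 4 * nrm (u - x))) => n.
  have n0 : 0 < n.+1%:R^-1 :> R by rewrite invr_gt0 ltr0n.
  have [w Dw lt_w] := S_m (u - x) n0.
  set q := u - x in ux0 lt_w *.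
  have -> : inner q q = inner (q - shift S (- 1) w) q + inner w r.
    by rewrite -rE // -innerDl subrK.
  have := nrmD (inner (q - shift S (- 1) w) q) (inner w r).
  have := nrm_inner_le (q - shift S (- 1) w) q; have := nrm_inner_le w r.
  have [_] := symmetric_shift_le (- 1) S_sym Dw; rewrite normrN1 mul1r.
  have := nrm_leD (shift S (- 1) w) q; rewrite (nrm_sub (shift _ _ _) q).
  have := ler_wpM2r (ltW ux0) (ltW lt_w).
  move: lt_w; move: (n.+1%:R^-1 : R) => k lt_w h1 h2 h3 h4 h5.
  have h6 : nrm w * nrm r <= (k + nrm q) * d.
    by rewrite ler_pM ?nrm_ge0 ?(ltW r_le) //; lra.
  lra.
exists u; split=> //; first by rewrite /d in ux *; lra.
have -> : S u - z = r - 'i *: (u - x) by rewrite /r; clin.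
have := nrmB r ('i *: (u - x)); rewrite nrmi; rewrite /d in ux r_le; lra.
Qed.

Lemma adjoint_is_closure : is_closure Sa S0.
Proof.
apply/seteqP; split=> -[x z] /=.
  move=> [/= xd ->]; apply/closure_nrm => e e0.
  have [u [Du ux uz]] := adjoint_graph_limit (adjoint_value xd) e0.
  by exists (u, S u); split=> //; split.
move=> /closure_nrm xz.
suff /(@adjoint_valueP _ _ _ S0 _ _ D_dense)[xd <-] : is_adjoint_value S0 x z by split.
apply: graph_limit_adjoint => e /xz[[u v] [[/= Du ->] ux uz]].
by exists u.
Qed.

Lemma adjoint_extends u : D u -> dom Sa u /\ Sa u = S u.
Proof.
move=> Du; apply: adjoint_valueP => // v /= Dv; exact: S_sym.
Qed.

Lemma adjoint_symmetric : symmetric_on (dom Sa) Sa.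
Proof.
move=> x y xd yd; set z := Sa x.
have xz := adjoint_graph_limit (adjoint_value xd).
apply: (@eq_of_nrm_le _ _ _ _ (4 * nrm y + 4 * nrm (Sa y))) => e e0.
have [u [Du ux uz]] := xz e e0.
have -> : inner z y - inner x (Sa y) = inner (u - x) (Sa y) - inner (S u - z) y.
  have uy : inner (S u) y = inner u (Sa y) := adjoint_value yd Du.
  by rewrite !innerE uy; clin.
have := nrmB (inner (u - x) (Sa y)) (inner (S u - z) y).
have := nrm_inner_le (u - x) (Sa y); have := nrm_inner_le (S u - z) y.
have := ler_wpM2r (nrm_ge0 y) uz; have := ler_wpM2r (nrm_ge0 (Sa y)) ux.
by rewrite -/Sa; lra.
Qed.

Lemma adjoint_dom_submodule : submodule (dom Sa).
Proof.
split.
- exists 0 => v _; have i0 w : inner w 0 = 0 :> A.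
    by apply: (addIr (inner w 0)); rewrite -innerDr !add0r.
  by rewrite !i0.
- by move=> x y [z xz] [z' yz']; exists (z + z') => v Dv; rewrite !innerDr xz ?yz'.
- by move=> l x [z xz]; exists (l *: z) => v Dv; rewrite !innerZr xz.
- by move=> x a [z xz]; exists (modact z a) => v Dv; rewrite !inner_act xz.
Qed.

Lemma adjoint_dom_dense : dense (dom Sa).
Proof.
apply/dense_nrm => x e e0; have [u Du xu] := (dense_nrm D).1 D_dense x e e0.
by exists u => //; exact: (adjoint_extends Du).1.
Qed.

Lemma adjoint_selfadjoint : selfadjoint Sa.
Proof.
split; first by split; [exact: adjoint_dom_submodule|exact: adjoint_dom_dense].
split=> x xd.
  have [] := @adjoint_valueP _ _ _ Sa x (Sa x) adjoint_dom_dense; last by split.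
  by move=> y yd; exact: adjoint_symmetric.
have xz : is_adjoint_value S0 x (adjoint Sa x).
  move=> u /= Du; have [ud uE] := adjoint_extends Du.
  by rewrite -uE (adjoint_value xd).
by have [] := @adjoint_valueP _ _ _ S0 x _ D_dense xz.
Qed.

(** [|u| <= |(S - i) u|] turns a sequence of approximate solutions into a
    Cauchy sequence; its limit lies in the domain of the closure. *)
Lemma adjoint_shift_surj w : exists2 x, dom Sa x & shift Sa (- 1) x = w.
Proof.
have /boolp.choice[u Hu] n : exists u, D u /\ nrm (w - shift S (- 1) u) < n.+1%:R^-1.
  have n0 : 0 < n.+1%:R^-1 :> R by rewrite invr_gt0 ltr0n.
  by have [u Du lt_u] := S_m w n0; exists u.
have [D0 DD DZ _] := D_sub.
have [SD SZ] := symmetric_linear D_sub D_dense S_sym.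
have Du n := (Hu n).1.
have [|x Hx] := @cvg_rate _ _ u 2.
  move=> m n le_nm.
  have DN : D (- u n) by rewrite -scaleN1r; exact: DZ.
  have Dmn : D (u m - u n) by exact: DD.
  have := (symmetric_shift_le (- 1) S_sym Dmn).2; rewrite normrN1 mul1r.
  have -> : shift S (- 1) (u m - u n) =
      (w - shift S (- 1) (u n)) - (w - shift S (- 1) (u m)).
    by rewrite /shift SD // -(scaleN1r (u n)) SZ //; clin.
  move=> h; apply: le_trans h _.
  have := nrmB (w - shift S (- 1) (u n)) (w - shift S (- 1) (u m)).
  have := (Hu n).2; have := (Hu m).2.
  have : m.+1%:R^-1 <= n.+1%:R^-1 :> R by rewrite lef_pV2 ?posrE ?ltr0n // ler_nat.
  by move: (m.+1%:R^-1 : R) (n.+1%:R^-1 : R) => k l; lra.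
have [xd xE] : dom Sa x /\ Sa x = w + 'i *: x.
  apply: adjoint_valueP => //; apply: graph_limit_adjoint => e e0.
  pose n := Num.trunc (3 / e).
  have n_le : 3 * n.+1%:R^-1 <= e.
    by rewrite ler_pdivrMr ?ltr0Sn // mulrC -ler_pdivrMr // ltW // truncnS_gt.
  have nn : 0 <= n.+1%:R^-1 :> R by rewrite invr_ge0.
  exists (u n); split=> //.
    by have := Hx n; move: n_le nn; move: (n.+1%:R^-1 : R) => k; lra.
  have -> : S (u n) - (w + 'i *: x) = 'i *: (u n - x) - (w - shift S (- 1) (u n)).
    by rewrite /shift; clin.
  have := nrmB ('i *: (u n - x)) (w - shift S (- 1) (u n)); rewrite nrmi.
  have := Hx n; have := (Hu n).2; move: n_le nn; move: (n.+1%:R^-1 : R) => k; lra.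
by exists x => //; rewrite /shift xE; clin.
Qed.

(** From [1 + S^2 = (S + i) (S - i)]: given [u] in [D] with [(S + i) u] close to
    the target, solve [(S - i) x = u] exactly in the domain of the closure. *)
Lemma adjoint_regular : regular Sa.
Proof.
have [_ [Sa_sub sub_Sa]] := adjoint_selfadjoint.
have Sa_dd : densely_defined Sa.
  by split; [exact: adjoint_dom_submodule|exact: adjoint_dom_dense].
have [_ SaD SaZ _] := adjoint_dom_submodule.
have [SD SZ] := symmetric_linear adjoint_dom_submodule adjoint_dom_dense
  adjoint_symmetric.
split.
- split=> //; apply/dense_nrm => x e e0.
  have [u ud xu] := (dense_nrm _).1 adjoint_dom_dense x e e0.
  by exists u => //; exact: (Sa_sub _ ud).1.
- by rewrite /closed_op adjoint_is_closure; exact: closed_closure.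
apply/dense_nrm => y e e0; have [u Du yu] := S_p y e0.
have [ud uE] := adjoint_extends Du.
have [x xd xE] := adjoint_shift_surj u.
have SxE : Sa x = u + 'i *: x by rewrite -xE /shift; clin.
have Sxd : dom Sa (Sa x) by rewrite SxE; apply: SaD => //; exact: SaZ.
have [Sxd' SSx] := Sa_sub _ Sxd.
exists (shift S 1 u) => //; exists x; first by [].
rewrite -[LHS]/(x + adjoint Sa (Sa x)) -SSx SxE SD //; last exact: SaZ.
by rewrite SZ // uE SxE /shift; clin.
Qed.

End Essential.

(** * Dense ranges for regular selfadjoint operators *)

Section SelfadjointRegular.
Context {R : realType} {A : cstarAlgebraType R} {E : hilbertModuleType A}.

Lemma symmetric_op_on (T : operator E) : symmetric_op T ->
  symmetric_on (dom T) T.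
Proof.
by move=> [_ TT] x y Tx Ty; have [yd ->] := TT y Ty; exact: adjoint_value.
Qed.

(** [1 + T^* T = (T + si) (T - si)] since [T^* = T] and [s^2 = 1]. *)
Lemma regular_dense_range (T : operator E) (s : R) : selfadjoint T -> regular T ->
  s ^+ 2 = 1 -> dense_range_on (dom T) (shift T s).
Proof.
move=> [[T_sub T_dense] [TT T_T]] [_ _ T_reg] s1 y e e0.
have T_sym : symmetric_on (dom T) T by apply: symmetric_op_on.
have [TD TZ] := symmetric_linear T_sub T_dense T_sym.
have [_ DD DZ _] := T_sub.
have [_ [x [_ [Tx T'Tx]] <-]] := (dense_nrm _).1 T_reg y e e0.
have [TTx TTE] := T_T _ T'Tx.
rewrite -[op_add _ _ x]/(x + adjoint T (T x)) TTE => lt_y.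
exists (T x + (- s)*i *: x); first by apply: DD => //; exact: DZ.
rewrite /shift TD ?TZ //; last exact: DZ.
have ss : s*i * (- s)*i = 1 :> R[i].
  by apply/eqP; rewrite eq_complex /= !mul0r mulrN sub0r opprK -expr2 s1 mulr0 addr0 !eqxx.
suff -> : T (T x) + (- s)*i *: T x + s*i *: (T x + (- s)*i *: x) = x + T (T x) by [].
by transitivity ((s*i * (- s)*i) *: x + T (T x)); [clin|rewrite ss scale1r].
Qed.

(** [dense_range_shift] allows multiplying the parameter by [3/2]. *)
Lemma dense_range_large (T : operator E) (s b : R) : selfadjoint T -> regular T ->
  s ^+ 2 = 1 -> exists2 m : R, 1 <= m /\ b <= m ^+ 2 &
  dense_range_on (dom T) (shift T (s * m)).
Proof.
move=> T_sa T_reg s1.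
have [[T_sub T_dense] [TT _]] := T_sa.
have T_sym : symmetric_on (dom T) T by apply: symmetric_op_on.
have as1 : `|s| = 1 by apply/eqP; rewrite -(@eqrXn2 _ 2) // -normrX s1 normr1 expr1n.
have grow n : exists2 m : R, 1 + n%:R / 2 <= m &
    dense_range_on (dom T) (shift T (s * m)).
  elim: n => [|n [m m_ge Tm]].
    by exists 1; rewrite ?mul0r ?addr0 // mulr1; exact: regular_dense_range.
  have m1 : 1 <= m by apply: le_trans m_ge; rewrite lerDl divr_ge0.
  exists (m + m / 2); first by rewrite -addn1 natrD; lra.
  apply: (dense_range_shift T_sub T_dense T_sym _ Tm).
  rewrite -mulrBr !normrM as1 !mul1r addrAC subrr add0r !ger0_norm; lra.
have [m m_ge Tm] := grow (Num.trunc (2 * b)).+1; exists m => //.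
have : 2 * b < (Num.trunc (2 * b)).+1%:R by rewrite truncnS_gt.
have : 0 <= (Num.trunc (2 * b)).+1%:R :> R by [].
move: m_ge; move: ((Num.trunc _).+1%:R : R) => k m_ge k0 bk.
have m1 : 1 <= m by lra.
have : m <= m * m by rewrite ler_peMl //; lra.
by rewrite expr2; split; lra.
Qed.

End SelfadjointRegular.

Unset Implicit Arguments.
Set Strict Implicit.

(** * Perturbation by a symmetric operator of relative bound one *)

Theorem theorem4p6 (R : realType) (A : cstarAlgebraType R)
    (E : hilbertModuleType A) (T V : operator E)
    (hTsa : selfadjoint T) (hTreg : regular T)
    (hV : symmetric_op V) (hdom : dom T `<=` dom V)
    (hb : exists2 b : R, 0 <= b & forall x : E, dom T x ->
       cle (inner (V x) (V x)) (inner (T x) (T x) + b%:C *: inner x x)) :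
  exists S : operator E,
    [/\ is_closure S (Operator (dom T) (fun x => T x + V x)),
        selfadjoint S & regular S].
Proof.
have [b b0 V_le] := hb.
have [[T_sub T_dense] [TT _]] := hTsa.
have T_sym : symmetric_on (dom T) T by apply: symmetric_op_on.
have V_sym : symmetric_on (dom T) V.
  by move=> x y /hdom Vx /hdom Vy; exact: (symmetric_op_on hV).
have S_sym : symmetric_on (dom T) (fun x => T x + V x).
  by move=> x y Tx Ty; rewrite !innerE T_sym ?V_sym.
have V_bound m x : b <= m ^+ 2 -> dom T x -> nrm (V x) <= nrm (shift T m x).
  move=> bm Tx; rewrite -ler_sqr ?nnegrE ?nrm_ge0 //.
  (* Both inequalities compare [y = (T + i sqrt b) x] with a sum of squares:
     [<y, y>] is [<V x, V x> + c^* c], and adding [(m^2 - b) <x, x>] to it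
     gives the square of [(T + im) x]. *)
  have [c cE] := V_le x Tx; have [v vE] := inner_pos (V x).
  pose y := shift T (Num.sqrt b) x.
  have yE : inner y y = inner (T x) (T x) + b%:C *: inner x x.
    by rewrite (symmetric_shift_sq _ T_sym Tx) -[in RHS](sqr_sqrtr b0) !innerE; clin.
  pose k := Num.sqrt (m ^+ 2 - b).
  have kk : k ^+ 2 = m ^+ 2 - b by rewrite sqr_sqrtr // subr_ge0.
  have mE : inner (shift T m x) (shift T m x) = inner y y + inner (k%:C *: x) (k%:C *: x).
    rewrite (symmetric_shift_sq _ T_sym Tx) yE (_ : b = m ^+ 2 - k ^+ 2);
      last by rewrite kk subKr.
    by rewrite !innerE; clin.
  apply: (@le_trans _ _ (nrm y ^+ 2)).
    rewrite -!nrm_inner yE -(subrK (inner (V x) (V x)) (_ + _)) cE vE addrC.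
    by rewrite nrm_starM nrm_starM_leD.
  by rewrite -[leRHS]nrm_inner mE nrm_inner_leD.
have S_dense s : s ^+ 2 = 1 -> dense_range_on (dom T) (shift (fun x => T x + V x) s).
  move=> s1; have [m [m1 bm] Tm] := dense_range_large b hTsa hTreg s1.
  have as1 : `|s| = 1 by apply/eqP; rewrite -(@eqrXn2 _ 2) // -normrX s1 normr1 expr1n.
  (* From the large parameter [m] back to [1]. *)
  apply: (@dense_range_shift _ _ _ _ T_sub T_dense _ (s * m)) => //.
    by rewrite -{1}(mulr1 s) -mulrBr !normrM as1 !mul1r distrC ger0_norm ?ger0_norm; lra.
  apply: dense_range_wuest => //.
    by rewrite -normr_gt0 normrM as1 mul1r normr_gt0; lra.
  by move=> x Tx; apply: V_bound => //; rewrite exprMn s1 mul1r.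
have [S_p S_m] : dense_range_on (dom T) (shift (fun x => T x + V x) 1) /\
    dense_range_on (dom T) (shift (fun x => T x + V x) (- 1)).
  by split; apply: S_dense; rewrite ?sqrrN expr1n.
exists (adjoint (Operator (dom T) (fun x => T x + V x))); split.
- exact: adjoint_is_closure.
- exact: adjoint_selfadjoint.
- exact: adjoint_regular.
Qed.
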